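(* The class of super topological spaces (that is, of topological spaces possessing a binary closed $k$-network) contains: (1) all supercompact spaces; (2) all generalized ordered spaces (GO-spaces); (3) all metrizable spaces; (4) all collectionwise normal $\aleph$-spaces.
   Context: A family $\mathcal N$ of subsets of a topological space $X$ is called: a $k$-network if for any open set $U\subset X$ and any compact set $K\subset U$ there exists a finite subfamily $\mathcal F\subset\mathcal N$ such that $K\subset\bigcup\mathcal F\subset U$; a closed $k$-network if it is a $k$-network and each $N\in\mathcal N$ is closed in $X$; linked if $A\cap B\neq\emptyset$ for any $A,B\in\mathcal N$; centered if $\bigcap\mathcal F\ne\emptyset$ for every finite nonempty subfamily $\mathcal F\subset\mathcal N$; binary if every linked subfamily of $\mathcal N$ is centered. A topological space is super if it possesses a binary closed $k$-network. A topological space $X$ is supercompact if its topology has a subbase $\mathcal B$ such that every cover $\mathcal U\subset\mathcal B$ of $X$ contains a two-element subcover $\{U_1,U_2\}\subset\mathcal U$. Regular spaces are understood to be Hausdorff. A regular space $X$ is a generalized ordered space (GO-space) if its topology has a base consisting of order-convex sets with respect to some linear order $\le$ on $X$, where $C\subset X$ is order-convex if $x,y\in C$ and $x\le z\le y$ imply $z\in C$. A regular space is an $\aleph$-space if it has a $\sigma$-discrete $k$-network. A family of subsets of $X$ is discrete if every point of $X$ has a neighborhood meeting at most one member of the family, and $\sigma$-discrete if it is a countable union of discrete families. A $T_1$ space $X$ is collectionwise normal if for every discrete family $(F_s)_{s\in S}$ of closed subsets of $X$ there is a discrete family $(U_s)_{s\in S}$ of open subsets of $X$ with $F_s\subset U_s$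 for all $s\in S$.
   Formalization: In (1) the supercompact space is assumed Hausdorff; without a separation axiom the claim fails, e.g. for the Sierpiński space, which is supercompact but has no closed k-network. *)

(* Defs.v *)
From mathcomp Require Import all_boot all_order all_algebra.
From mathcomp Require Import all_classical all_reals all_analysis.

Set Implicit Arguments.
Unset Strict Implicit.
Unset Printing Implicit Defensive.

Import Order.TTheory GRing.Theory Num.Theory.

Local Open Scope classical_set_scope.

Section set_systems.
Context {T : Type}.
Implicit Types N F : set_system T.

(* Taking A = B shows that all members of a linked family are nonempty. *)
Definition linked N := forall A B, N A -> N B -> A `&` B !=set0.

Definition centered N := forall F, finite_set F -> F !=set0 -> F `<=` N ->
  \bigcap_(A in F) A !=set0.

Definition binary N := forall F, F `<=` N -> linked F -> centered F.

End set_systems.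

Section networks.
Context {X : topologicalType}.
Implicit Types N : set_system X.

Definition k_network N := forall K U : set X, compact K -> open U -> K `<=` U ->
  exists F : set_system X,
    [/\ finite_set F, F `<=` N, K `<=` \bigcup_(A in F) A
      & \bigcup_(A in F) A `<=` U].

Definition closed_k_network N := k_network N /\ N `<=` closed.

(* [D] is the index set of the family; a family given as a set of sets [N] is
   [discrete_family N id]. *)
Definition discrete_family (I : Type) (D : set I) (F : I -> set X) :=
  forall x : X, exists2 O : set X, nbhs x O &
    forall i j, D i -> D j -> F i `&` O !=set0 -> F j `&` O !=set0 -> i = j.

Definition sigma_discrete N := exists2 Nn : nat -> set_system X,
  forall n, discrete_family (Nn n) id & N = \bigcup_n Nn n.

Definition subbase (B : set_system X) :=
  B `<=` open /\ basis (finI_from B id).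

End networks.

Definition order_convex (T : Type) (le : rel T) (C : set T) :=
  forall x y z, C x -> C y -> le x z -> le z y -> C z.

Section spaces.
Variable X : topologicalType.

Definition super := exists2 N : set_system X, closed_k_network N & binary N.

(* [U1] and [U2] may coincide: a cover having [X] itself as a member qualifies. *)
Definition supercompact := exists2 B : set_system X, subbase B &
  forall V : set_system X, V `<=` B -> \bigcup_(U in V) U = [set: X] ->
  exists U1 U2, [/\ V U1, V U2 & U1 `|` U2 = [set: X]].

(* The library's [regular_space] does not include any separation of points. *)
Definition regular_hausdorff := hausdorff_space X /\ @regular_space X.

Definition GO_space := regular_hausdorff /\
  exists le : rel X,
    [/\ reflexive le, antisymmetric le, transitive le & total le] /\
    exists2 B : set_system X, basis B & B `<=` order_convex le.

Definition metrizable (R : realType) := exists d : X -> X -> R,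
  [/\ forall x y, d x y = 0%R <-> x = y,
      forall x y, d x y = d y x,
      forall x y z, (d x z <= d x y + d y z)%R
    & forall x, nbhs x = nbhs_ball_ (fun x e => [set y | (d x y < e)%R]) x].

Definition aleph_space := regular_hausdorff /\
  exists2 N : set_system X, k_network N & sigma_discrete N.

Definition collectionwise_normal := accessible_space X /\
  forall (I : Type) (D : set I) (F : I -> set X),
    (forall i, D i -> closed (F i)) -> discrete_family D F ->
    exists U : I -> set X,
      [/\ forall i, D i -> open (U i), discrete_family D U
        & forall i, D i -> F i `<=` U i].

End spaces.

(* Main.v *)
Require Import Defs.
From mathcomp Require Import all_boot all_order all_algebra finmap.
From mathcomp Require Import all_classical all_reals all_analysis.
From mathcomp Require wochoice.
From mathcomp Require Import lra.

(** The complements of the members of the subbase of a supercompact space form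
    a binary family, and finite intersections of them do too; by compactness
    these finite intersections are a k-network ([supercompact_super]).  In a
    GO-space the closed order-convex sets are a k-network, and they are binary
    by the theorem of Helly on the line ([GO_super]).

    The other two classes are collectionwise normal and have a closed k-network
    that is a union of discrete families [N 0], [N 1], ...; for metrizable spaces
    this is a theorem of Stone.  [discrete_k_network_super] covers both.  It
    contains the theorem of Strok and Szymanski that compact metrizable spaces
    are supercompact.  Every member of every [N l] is cut into closed pieces,
    locally finitely, in such a way that all the pieces together are binary.
    Pieces of [C] are subsets of [C], so that they form a k-network again.

    Suppose that finitely many discrete families of pieces [A i], together
    binary, have been constructed, and that a closed set [D] is to be covered by
    new ones.  The type of a point is the set of all [i] with [x] in [A i], and
    its degree is the size of the type.  In the order of decreasing degree, the
    points of [D] of a given type are covered by an open cell [M u] around a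
    center [u] of that type.  The closure of [M u] meets only those [A i] that
    contain [u], and two cells whose closures meet have comparable types
    ([cells_exist]).  Cells are then trimmed to pieces that have disjoint and
    dense kernels.  A linked family of new pieces is thus a chain for the
    inclusion of types, and the [A i] linked with all of them contain the center
    of the smallest type.  A common point need not exist, and so it is added by
    force: where the piece of the greatest type meets the piece of the smallest
    type, infinitely many points of the kernel of the former are as close as
    wanted to all [A i] in question.  Such a point belongs to no other piece and
    has a small type; when it is added to all the sets of the linked family, no
    new pair of intersecting sets arises ([refinement_exists]).  The chains below
    a given piece are finite in number and receive distinct points.

    Two difficulties remain.  The points added to a piece [A i] of [B] in [N l]
    have to lie in [B].  The set [D] is therefore a stratum of the union of [N l]
    on which the number of the members of [N 0], ..., [N l] through a point is
    constant, because there each [B] is relatively open; the new pieces are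
    thickened afterwards, and what they leave uncovered is dealt with in lower
    strata ([stage_step], [stage_process]).  Secondly, a piece receives points at
    infinitely many stages.  Each piece has at every stage an open hull, two
    hulls meet only if the pieces do ([swelling]), and the closure of the next
    hull is inside the present one.  The closure of the union of all stages of a
    piece is in all its hulls, so that it meets no more of the other limits than
    the pieces met each other ([limit_binary]). *)

Set Implicit Arguments.
Unset Strict Implicit.
Unset Printing Implicit Defensive.

Import Order.TTheory GRing.Theory Num.Theory.

Local Open Scope classical_set_scope.

(** * Networks in compact spaces *)

Lemma finI_fromP (T : Type) (N : set_system T) (A : set T) :
  finI_from N id A <->
  exists F : set_system T, [/\ finite_set F, F `<=` N & A = \bigcap_(B in F) B].
Proof.
split=> [[D DN <-]|[F [finF FN ->]]].
  exists (fun B => B \in D); split => //; first exact: finite_fset.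
  by move=> B /DN; rewrite inE.
exists (fset_set F).
  by move=> B; rewrite in_fset_set// !inE => /FN.
by rewrite fset_setK.
Qed.

Section networks.
Variable X : topologicalType.

Lemma compact_finite_cover (K : set X) (W : X -> set X) :
  compact K -> (forall x, K x -> nbhs x (W x)) ->
  exists F : set X, [/\ finite_set F, F `<=` K & K `<=` \bigcup_(x in F) W x].
Proof.
move=> cK nW; apply: contrapT => ncov.
pose fin := [set F : set X | finite_set F /\ F `<=` K].
have fin0 : fin set0 by split; [exact: finite_set0|exact: sub0set].
pose Fi := filter_from fin (fun F => K `\` \bigcup_(x in F) W x).
have FiP : ProperFilter Fi.
  apply: filter_from_proper; last first.
    move=> F [finF FK]; apply: contrapT => nex; apply: ncov; exists F.
    split=> // x Kx; apply: contrapT => nx; apply: nex; exists x.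
    by split.
  apply: filter_from_filter; first by exists set0.
  move=> F G [finF FK] [finG GK]; exists (F `|` G); last first.
    by rewrite bigcup_setU setDUr.
  by split; [rewrite finite_setU|move=> x [/FK|/GK]].
have [|x [Kx clx]] := cK Fi FiP; first by exists set0 => // x [].
have [|y [[_ ny] Wy]] := clx (K `\` W x) (W x) _ (nW x Kx).
  exists [set x]; last by rewrite bigcup_set1.
  by split; [exact: finite_set1|move=> _ ->].
exact: ny.
Qed.

(** Compactness makes it enough to find, around each point of an open set, a
    neighbourhood that is a finite union of members. *)
Lemma local_k_network (N : set_system X) :
  (forall x (U : set X), open U -> U x -> exists F : set_system X,
    [/\ finite_set F, F `<=` N, \bigcup_(A in F) A `<=` U
      & nbhs x (\bigcup_(A in F) A)]) ->
  k_network N.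
Proof.
move=> locN K U cK oU KU.
have /choice[G HG] : forall x, exists F : set_system X, K x ->
    [/\ finite_set F, F `<=` N, \bigcup_(A in F) A `<=` U
      & nbhs x (\bigcup_(A in F) A)].
  move=> x; have [Kx|nKx] := pselect (K x); last by exists set0.
  by have [F HF] := locN x U oU (KU _ Kx); exists F.
have [|F [finF FK KF]] :=
  @compact_finite_cover K (fun x => \bigcup_(A in G x) A) cK.
  by move=> x /HG[].
exists (\bigcup_(x in F) G x); split.
- by apply: bigcup_finite => // x /FK /HG[].
- by move=> A [x /FK /HG[_ GN _ _]] /GN.
- by move=> x /KF[y Fy [A GA Ax]]; exists A => //; exists y.
- by move=> x [A [y /FK /HG[_ _ GU _] GA] Ax]; apply: GU; exists A.
Qed.

End networks.

(** * Supercompact spaces *)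

Section supercompact.
Variable X : topologicalType.
Implicit Types (N : set_system X) (A B : set X).

Definition finite_union N A := exists F : set_system X,
  [/\ finite_set F, F `<=` N & A = \bigcup_(B in F) B].

Lemma finite_unionI N A B : (forall C D, N C -> N D -> N (C `&` D)) ->
  finite_union N A -> finite_union N B -> finite_union N (A `&` B).
Proof.
move=> NI [F [finF FN ->]] [G [finG GN ->]].
exists ((fun CD => CD.1 `&` CD.2) @` (F `*` G)); split.
- by apply: finite_image; exact: finite_setX.
- by move=> _ [[C D] [/= /FN ? /GN ?] <-]; exact: NI.
- apply/seteqP; split => [x [[C FC Cx] [D GD Dx]]|x [_ [[C D] [/= FC GD] <-]]].
    by exists (C `&` D) => //; exists (C, D).
  by move=> [Cx Dx]; split; [exists C|exists D].
Qed.

Lemma finite_union1 N A : N A -> finite_union N A.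
Proof.
move=> NA; exists [set A]; split; first exact: finite_set1.
  by move=> _ ->.
by rewrite bigcup_set1.
Qed.

Definition complements N : set_system X := setC @` N.

Lemma finite_union_setC_finI N A : finI_from N id A ->
  finite_union (finI_from (complements N) id) (~` A).
Proof.
move=> /finI_fromP[F [finF FN ->]]; rewrite setC_bigcap.
exists (setC @` F); split.
- exact: finite_image.
- by move=> _ [B FB <-]; apply: (@finI_from1 _ _ _ id); exists B => //; exact: FN.
- by rewrite bigcup_image.
Qed.

(** The argument is that of the Alexander subbase theorem: if an ultrafilter
    had no limit, the members of the subbase outside of it would be a cover, and
    one of any two sets that cover [X] belongs to the ultrafilter. *)
Lemma supercompact_compact (B : set_system X) : subbase B ->
  (forall V : set_system X, V `<=` B -> \bigcup_(U in V) U = [set: X] ->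
   exists U1 U2, [/\ V U1, V U2 & U1 `|` U2 = [set: X]]) ->
  compact [set: X].
Proof.
move=> [Bo [_ Bb]] sc; rewrite compact_ultra => F FU _.
apply: contrapT => nF.
have nlim p : exists2 U, B U /\ U p & ~ F U.
  apply: contrapT => nU; apply: nF; exists p; split => //= A /Bb.
  move=> [_ [[D DB <-] Dp] DA]; apply: (filterS DA).
  apply: filter_bigI => U UD; apply: contrapT => nFU; apply: nU.
  exists U => //; split; last exact: Dp.
  by have := DB _ UD; rewrite inE.
have [||U1 [U2 [[_ F1] [_ F2] U12]]] := sc (fun U => B U /\ ~ F U).
- by move=> U [].
- by apply/seteqP; split => // p _; have [U [BU Up] nFU] := nlim p; exists U.
have [FU1|FC] := in_ultra_setVsetC U1 FU; first exact: F1.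
apply: F2; apply: filterS FC => x nU1.
by have [/nU1|] : (U1 `|` U2) x by rewrite U12.
Qed.

(** The complements of the members of the subbase are binary by
    supercompactness.  This passes to their finite intersections, because two
    complements are linked as soon as they contain linked sets. *)
Lemma supercompact_binary (B : set_system X) :
  (forall V : set_system X, V `<=` B -> \bigcup_(U in V) U = [set: X] ->
   exists U1 U2, [/\ V U1, V U2 & U1 `|` U2 = [set: X]]) ->
  binary (finI_from (complements B) id).
Proof.
move=> sc F FN linkF G _ _ GF.
pose V := [set U | B U /\ exists2 A, F A & A `<=` ~` U].
suff [p Vp] : exists p, forall U, V U -> ~ U p.
  exists p => A /GF FA; have /finI_fromP[D [_ DC AE]] := FN _ FA.
  rewrite AE => C DC'; have [U BU UE] := DC _ DC'.
  rewrite -UE; apply: Vp; split=> //; exists A => //.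
  by rewrite AE => y /(_ _ DC'); rewrite -UE.
apply: contrapT => nV.
have [||U1 [U2 [[_ [A1 FA1 A1U]] [_ [A2 FA2 A2U]] U12]]] := sc V.
- by move=> U [].
- apply/seteqP; split => // p _; apply: contrapT => np; apply: nV.
  by exists p => U VU Up; apply: np; exists U.
have [x [/A1U nU1 /A2U nU2]] := linkF _ _ FA1 FA2.
by have [] : (U1 `|` U2) x by rewrite U12.
Qed.

Theorem supercompact_super : hausdorff_space X -> supercompact X -> super X.
Proof.
move=> hX [B subB sc].
have cX := supercompact_compact subB sc.
have [Bo Bbas] := subB.
pose N := finI_from (complements B) id.
have NI C D : N C -> N D -> N (C `&` D) by exact: finI_fromI.
exists N; last exact: supercompact_binary.
split; last first.
  move=> A /finI_fromP[F [_ FC ->]]; apply: closed_bigI => _ /FC[U BU <-].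
  by apply: open_closedC; exact: Bo.
apply: local_k_network => x U oU Ux.
have cU : compact (~` U).
  by apply: (@subclosed_compact _ _ setT) => //; exact: open_closedC.
have sep y : exists VW : set X * set X, (~` U) y ->
    [/\ finI_from B id VW.1, finI_from B id VW.2, VW.1 x, VW.2 y
      & VW.1 `&` VW.2 = set0].
  have [nUy|Uy] := pselect ((~` U) y); last by exists (set0, set0).
  have xy : x != y by apply/eqP => xy; apply: nUy; rewrite -xy.
  move: (hX); rewrite open_hausdorff => /(_ _ _ xy) [[V W] /= [xV yW]].
  move=> [oV oW /eqP VW0].
  have [bo bn] := Bbas.
  have /bn[V' [bV V'x] V'V] : nbhs x V.
    by apply: open_nbhs_nbhs; split => //; rewrite -inE.
  have /bn[W' [bW W'y] W'W] : nbhs y W.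
    by apply: open_nbhs_nbhs; split => //; rewrite -inE.
  exists (V', W') => _ /=; split=> //.
  by apply/seteqP; split => // z [/V'V Vz /W'W Wz]; rewrite -VW0; split.
have {sep}[VW HVW] := choice sep.
have [|F [finF FU UF]] := @compact_finite_cover X _ (fun y => (VW y).2) cU.
  move=> y /HVW[_ bW _ Wy _]; apply: open_nbhs_nbhs; split => //.
  by have [bo _] := Bbas; apply: bo.
(* [U] contains a finite intersection of complements of the basic sets around
   the points outside [U]; each such complement is a finite union of members. *)
suff [A fA [AU nA]] : exists2 A, finite_union N A & A `<=` U /\ nbhs x A.
  by have [G [finG GN AE]] := fA; exists G; rewrite -AE; split.
have {finF} [s Fs] := (finite_seqP F).1 finF.
have FU' y : y \in s -> (~` U) y by move=> ys; apply: FU; rewrite Fs.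
have [A fA [AW nA]] : exists2 A, finite_union N A &
    (forall y, y \in s -> A `<=` ~` (VW y).2) /\ nbhs x A.
  elim: s FU' {F FU UF Fs} => [_|y s IHs FU].
    exists setT; last by split=> //; exact: filterT.
    apply: finite_union1; apply/finI_fromP; exists set0.
    by split; [exact: finite_set0|exact: sub0set|rewrite bigcap_set0].
  have [|A fA [AW nA]] := IHs; first by move=> z zs; apply: FU; rewrite inE zs orbT.
  have [|bV bW Vx Wy VW0] := HVW y; first by apply: FU; rewrite inE eqxx.
  exists (A `&` ~` (VW y).2).
    by apply: finite_unionI => //; exact: finite_union_setC_finI.
  split.
    by move=> z; rewrite inE => /orP[/eqP->|/AW Az] t [At nt] //; exact: Az.
  apply: filterI => //; apply: (@filterS _ _ _ (VW y).1).
    by move=> z Vz Wz; have : set0 z by rewrite -VW0.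
  apply: open_nbhs_nbhs; split=> //.
  by have [bo _] := Bbas; apply: bo.
exists A => //; split=> // z Az; apply: contrapT => nUz.
have [y Fy Wz] := UF z nUz.
by apply: (AW y _ z) => //; move: Fy; rewrite Fs.
Qed.

End supercompact.

(** * Generalized ordered spaces *)

Section order_convex.
Variables (T : Type) (le : rel T).
Hypothesis le_total : total le.
Implicit Types A B C : set T.

Lemma order_convexI A B :
  order_convex le A -> order_convex le B -> order_convex le (A `&` B).
Proof.
move=> cA cB x y z [Ax Bx] [Ay By] xz zy.
by split; [exact: cA xz zy|exact: cB xz zy].
Qed.

(** The middle one of three points chosen in the pairwise intersections lies in
    all three sets. *)
Lemma order_convex_helly3 A B C :
  order_convex le A -> order_convex le B -> order_convex le C ->
  A `&` B !=set0 -> B `&` C !=set0 -> A `&` C !=set0 ->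
  A `&` B `&` C !=set0.
Proof.
move=> cA cB cC [x [Ax Bx]] [y [By Cy]] [z [Az Cz]].
have [xy|yx] := orP (le_total x y); have [yz|zy] := orP (le_total y z);
  have [xz|zx] := orP (le_total x z).
- by exists y; split=> //; split=> //; exact: cA xy yz.
- by exists y; split=> //; split=> //; exact: cA xy yz.
- by exists z; split=> //; split=> //; exact: cB xz zy.
- by exists x; split; [split|exact: cC zx xy].
- by exists x; split; [split|exact: cC yx xz].
- by exists z; split=> //; split=> //; exact: cB yz zx.
- by exists y; split=> //; split=> //; exact: cA zy yx.
- by exists y; split=> //; split=> //; exact: cA zy yx.
Qed.

(** By induction, the traces of the other sets on the first one are again
    convex and, by the case of three sets, linked. *)
Lemma order_convex_helly (s : seq (set T)) : (0 < size s)%N ->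
  (forall A, A \in s -> order_convex le A) ->
  (forall A B, A \in s -> B \in s -> A `&` B !=set0) ->
  exists x, forall A, A \in s -> A x.
Proof.
have [n] := ubnP (size s); elim: n s => // n IHn [//|A [|B s]] /= sn _ cs ls.
  have [||x [Ax _]] := ls A A; rewrite ?inE//.
  by exists x => C; rewrite inE => /eqP ->.
have [||||x Hx] := IHn [seq A `&` C | C <- B :: s].
- by rewrite size_map.
- by [].
- move=> _ /mapP[C Cs ->]; apply: order_convexI; apply: cs;
    by rewrite inE ?eqxx// Cs orbT.
- move=> _ _ /mapP[C Cs ->] /mapP[D Ds ->].
  have As : A \in [:: A, B & s] by rewrite inE eqxx.
  have {}Cs : C \in [:: A, B & s] by rewrite inE Cs orbT.
  have {}Ds : D \in [:: A, B & s] by rewrite inE Ds orbT.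
  have [y [[Ay Cy] Dy]] := order_convex_helly3 (cs _ As) (cs _ Cs) (cs _ Ds)
    (ls _ _ As Cs) (ls _ _ Cs Ds) (ls _ _ As Ds).
  by exists y.
exists x => C; rewrite inE => /orP[/eqP->|Cs].
  by have [] : (A `&` B) x by apply: Hx; rewrite map_f// inE eqxx.
by have [] : (A `&` C) x by apply: Hx; rewrite map_f.
Qed.

End order_convex.

Section GO.
Variables (X : topologicalType) (le : rel X).
Hypothesis le_total : total le.
Variable B : set_system X.
Hypotheses (basisB : basis B) (convB : B `<=` order_convex le).
Hypothesis hX : hausdorff_space X.

(** A convex neighbourhood of [x] that omits [z] lies on the same side of [z] as
    [x]. *)
Lemma nbhs_lt x z : le x z -> x != z -> \forall y \near x, le y z.
Proof.
move=> xz nxz; move: hX; rewrite open_hausdorff => /(_ _ _ nxz).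
move=> [[U V] /= [xU zV] [oU oV /eqP UV0]].
have [_ /(_ x U)[|W [BW Wx] WU]] := basisB.
  by apply: open_nbhs_nbhs; split => //; rewrite -inE.
apply: (@filterS _ _ _ W).
  move=> y Wy; have [//|zy] := orP (le_total y z).
  have /WU Uz : W z by exact: (convB BW) Wx Wy xz zy.
  by have : set0 z by rewrite -UV0; split => //; rewrite -inE.
by apply: open_nbhs_nbhs; split => //; have [oB _] := basisB; apply: oB.
Qed.

Lemma nbhs_gt x z : le z x -> x != z -> \forall y \near x, le z y.
Proof.
move=> zx nxz; move: hX; rewrite open_hausdorff => /(_ _ _ nxz).
move=> [[U V] /= [xU zV] [oU oV /eqP UV0]].
have [_ /(_ x U)[|W [BW Wx] WU]] := basisB.
  by apply: open_nbhs_nbhs; split => //; rewrite -inE.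
apply: (@filterS _ _ _ W).
  move=> y Wy; have [yz|//] := orP (le_total y z).
  have /WU Uz : W z by exact: (convB BW) Wy Wx yz zx.
  by have : set0 z by rewrite -UV0; split => //; rewrite -inE.
by apply: open_nbhs_nbhs; split => //; have [oB _] := basisB; apply: oB.
Qed.

(** A point [z] between two points of the closure of [C] has points of [C] on
    both sides, by openness of the rays. *)
Lemma order_convex_closure C : order_convex le C -> order_convex le (closure C).
Proof.
move=> cC x y z clx cly xz zy.
have [->//|nxz] := eqVneq z x; have [->//|nyz] := eqVneq z y.
have [|u [Cu uz]] := clx _ (nbhs_lt xz _); first by rewrite eq_sym.
have [|v [Cv zv]] := cly _ (nbhs_gt zy _); first by rewrite eq_sym.
by apply: subset_closure; exact: cC uz zv.
Qed.

End GO.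

Theorem GO_super (X : topologicalType) : GO_space X -> super X.
Proof.
move=> [[hX regX] [le [[le_refl le_anti le_trans le_total] [B basisB convB]]]].
exists [set C | closed C /\ order_convex le C].
  split; last by move=> C [].
  apply: local_k_network => x U oU Ux.
  have [|V nV VU] := regX x U; first exact: open_nbhs_nbhs.
  have [_ /(_ x V nV)[W [BW Wx] WV]] := basisB.
  exists [set closure W]; rewrite bigcup_set1; split.
  - exact: finite_set1.
  - move=> _ ->; split; first exact: closed_closure.
    by apply: order_convex_closure basisB _ _ _ _ => //; exact: convB.
  - by apply: subset_trans VU; exact: closureS.
  - apply: filterS (@subset_closure _ W) _.
    by apply: open_nbhs_nbhs; split => //; have [oB _] := basisB; apply: oB.
move=> F FN linkF G finG [A GA] GF.
have [s Gs] := (finite_seqP G).1 finG.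
have sG C : C \in s -> G C by rewrite Gs.
have [|||x Hx] := @order_convex_helly _ _ le_total s.
- by move: GA; rewrite Gs /=; case: (s).
- by move=> C /sG /GF /FN[].
- by move=> C D /sG /GF ? /sG /GF ?; exact: linkF.
by exists x => C; rewrite Gs => /Hx.
Qed.

(** * Conservative and coloured families *)

Section conservative.
Variable X : topologicalType.

(** These are the families of closed sets all of whose subfamilies have closed
    unions.  In this form, the type of a point is an upper semicontinuous
    function of the point. *)
Definition conservative (I : Type) (F : I -> set X) :=
  forall x, \forall y \near x, forall i, F i y -> F i x.

Lemma conservative_closed (I : Type) (F : I -> set X) i :
  conservative F -> closed (F i).
Proof.
by move=> cF x /(_ _ (cF x)) [y [Fy]]; apply.
Qed.

Lemma closed_near (A : set X) x : closed A -> \forall y \near x, A y -> A x.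
Proof.
move=> cA; have [Ax|nAx] := pselect (A x); first exact: nearW.
have : nbhs x (~` A) by apply: open_nbhs_nbhs; split => //; exact: closed_openC.
by apply: filterS => y nAy /nAy.
Qed.

Lemma discrete_conservative (I : Type) (D : set I) (F : I -> set X) :
  discrete_family D F -> (forall i, D i -> closed (F i)) ->
  conservative (fun i => [set x | D i /\ F i x]).
Proof.
move=> dF cF x; have [W nW HW] := dF x.
have [[i [Di [z [Fz Wz]]]]|ni] := pselect (exists i, D i /\ F i `&` W !=set0).
  near=> y => j [Dj Fy]; split => //.
  have Wy : W y by near: y.
  have ij : i = j by apply: HW => //; [exists z|exists y].
  rewrite -ij in Fy *; move: Fy; near: y; apply: closed_near; exact: cF.
near=> y => j [Dj Fy]; exfalso; apply: ni; exists j; split=> //.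
by exists y; split=> //; near: y.
Unshelve. all: by end_near. Qed.

Lemma conservative_discrete (I : Type) (F : I -> set X) :
  conservative F -> (forall i j x, F i x -> F j x -> i = j) ->
  discrete_family setT F.
Proof.
move=> cF dF x; exists [set y | forall i, F i y -> F i x]; first exact: cF.
move=> i j _ _ [y [Fiy Hy]] [z [Fjz Hz]].
by apply: (dF i j x); [exact: Hy|exact: Hz].
Qed.

Section coloured.
Variables (I : Type) (col : I -> nat) (n : nat).

(** Together with conservativity this encodes a union of [n] discrete families
    of closed sets.  A point lies in at most one set of each colour, whence all
    finiteness properties below. *)
Definition coloured (F : I -> set X) :=
  (forall i, F i !=set0 -> (col i < n)%N) /\
  (forall i j x, F i x -> F j x -> col i = col j -> i = j).

Variables (F : I -> set X).
Hypothesis colF : coloured F.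

Lemma coloured_near_forall (J : Type) (G : set_system J) (P : I -> J -> Prop) x :
  Filter G -> (forall i, F i x -> \forall y \near G, P i y) ->
  \forall y \near G, forall i, F i x -> P i y.
Proof.
move=> FG H; have [Fn Fd] := colF.
have : \forall y \near G, forall c : 'I_n, forall i, F i x -> col i = c -> P i y.
  apply: filter_forall => c.
  have [[i Fi ic]|ni] := pselect (exists2 i, F i x & col i = c).
    apply: filterS (H i Fi) => y Py j Fj jc.
    by rewrite -(Fd i j x) // ic jc.
  by apply: nearW => y i Fi ic; exfalso; apply: ni; exists i.
apply: filterS => y Hy i Fi.
have ni : (col i < n)%N by apply: Fn; exists x.
exact: (Hy (Ordinal ni)).
Qed.

Lemma coloured_finite x : finite_set [set i | F i x].
Proof.
have [Fn Fd] := colF.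
have : finite_set (col @` [set i | F i x]).
  apply: (@sub_finite_set _ _ `I_n) (finite_II n).
  by move=> _ [i Fi <-] /=; apply: Fn; exists x.
rewrite (eq_finite_set (inj_card_eq _)) // => i j /set_mem Fi /set_mem Fj.
exact: Fd Fi Fj.
Qed.

Lemma coloured_closed_sub (E : I -> set X) : conservative F ->
  (forall i, E i `<=` F i) -> (forall i, closed (E i)) -> conservative E.
Proof.
move=> cF EF cE x; near=> y => i Ey.
have Fix : F i x.
  by apply: (near (cF x) y) => //; exact: EF.
move: i Fix Ey; near: y; apply: coloured_near_forall => i Fi.
exact: closed_near.
Unshelve. all: by end_near. Qed.

Lemma coloured_compact (K : set X) : conservative F -> compact K ->
  finite_set [set i | exists2 x, K x & F i x].
Proof.
move=> cF cK.
have [x _|G [finG _ KG]] := @compact_finite_cover X K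
  (fun x => [set y | forall i, F i y -> F i x]) cK; first exact: cF.
apply: (@sub_finite_set _ _ (\bigcup_(x in G) [set i | F i x])).
  by move=> i [y /KG[x Gx /(_ i) H] /H Fi]; exists x.
by apply: bigcup_finite => // x _; exact: coloured_finite.
Qed.

Definition colours x : {set 'I_n} :=
  [set c : 'I_n | `[< exists2 i, F i x & col i = c :> nat >]]%SET.

Lemma coloursP x (c : 'I_n) :
  reflect (exists2 i, F i x & col i = c :> nat) (c \in colours x).
Proof. by rewrite inE; exact: asboolP. Qed.

(** For conservative families the degree cannot increase near a point, and a
    nearby point of the same degree has the same type ([degree_eq]). *)
Definition degree x := #|colours x|.

Lemma degree_le x : (degree x <= n)%N.
Proof. by rewrite -[leqRHS]card_ord max_card. Qed.

Lemma colours_sub x y : (forall i, F i x -> F i y) ->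
  colours x \subset colours y.
Proof.
move=> xy; apply/fintype.subsetP => c /coloursP[i Fi ic].
by apply/coloursP; exists i => //; exact: xy.
Qed.

Lemma degree_sub x y : (forall i, F i x -> F i y) -> (degree x <= degree y)%N.
Proof. by move=> /colours_sub /subset_leq_card. Qed.

Lemma colours_inj u x y : (forall i, F i x -> F i u) -> (forall i, F i y -> F i u) ->
  colours x \subset colours y -> forall i, F i x -> F i y.
Proof.
have [Fn Fd] := colF.
move=> xu yu /fintype.subsetP xy i Fi.
have ni : (col i < n)%N by apply: Fn; exists x.
have /xy /coloursP[j Fj ij] : Ordinal ni \in colours x by apply/coloursP; exists i.
by rewrite (Fd i j u) //; [exact: xu|exact: yu].
Qed.

Lemma degree_eq x y : (forall i, F i x -> F i y) -> (degree y <= degree x)%N ->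
  forall i, F i y -> F i x.
Proof.
move=> xy le_yx; apply: (@colours_inj y) => //.
have /eqP -> // : colours x == colours y.
by rewrite eqEcard colours_sub.
Qed.

End coloured.

End conservative.

(** * Expansions in collectionwise normal spaces *)

Section collectionwise_normal.
Variable X : topologicalType.
Hypothesis cwnX : collectionwise_normal X.

Lemma collectionwise_normal_normal (Y G : set X) :
  closed Y -> open G -> Y `<=` G ->
  exists M : set X, [/\ open M, Y `<=` M & closure M `<=` G].
Proof.
move=> cY oG YG; have [_ cwn] := cwnX.
have [||U [oU dU YU]] := cwn bool setT (fun b => if b then Y else ~` G).
- by move=> [] _ //; exact: open_closedC.
- move=> x; have [Gx|nGx] := pselect (G x).
    exists G; first exact: open_nbhs_nbhs.
    by case=> -[] _ _ [y [Fy Wy]] [z [Fz Wz]] //.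
  exists (~` Y).
    by apply: open_nbhs_nbhs; split; [exact: closed_openC|move=> /YG].
  by case=> -[] _ _ [y [Fy Wy]] [z [Fz Wz]] //.
exists (U true); split; [exact: (oU true)|exact: (YU true)|].
move=> x clx; apply: contrapT => nGx.
have [W nW HW] := dU x.
have Ux : U false x by exact: (YU false).
have [|y [Uy Wy]] := clx W; first by [].
suff : true = false by [].
apply: HW => //; first by exists y.
by exists x; split => //; exact: nbhs_singleton.
Qed.

(** The closures of the expansions lie in the members of a discrete open
    family, so that near a point only one of them has to be considered. *)
Lemma discrete_expansion (J : Type) (Y G : J -> set X) :
  conservative Y -> (forall i j x, Y i x -> Y j x -> i = j) ->
  (forall j, open (G j)) -> (forall j, Y j `<=` G j) ->
  exists M : J -> set X,
    [/\ forall j, open (M j), forall j, Y j `<=` M j,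
        forall j, closure (M j) `<=` G j,
        conservative (fun j => closure (M j))
      & forall i j x, closure (M i) x -> closure (M j) x -> i = j].
Proof.
move=> cY dY oG YG; have [_ cwn] := cwnX.
have [|U [oU dU YU]] := cwn J setT Y _ (conservative_discrete cY dY).
  by move=> j _; exact: conservative_closed.
have /choice[M HM] : forall j, exists M : set X,
    [/\ open M, Y j `<=` M & closure M `<=` U j `&` G j].
  move=> j; apply: collectionwise_normal_normal.
  - exact: conservative_closed.
  - by apply: openI => //; exact: oU.
  - by move=> x Yx; split; [exact: YU|exact: YG].
exists M; split.
- by move=> j; have [] := HM j.
- by move=> j; have [] := HM j.
- by move=> j; have [_ _] := HM j => MUG x /MUG[].
- move=> x; have [W nW HW] := dU x.
  have [[i [z [Uz Wz]]]|ni] := pselect (exists i, U i `&` W !=set0).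
    have ci : closed (closure (M i)) by exact: closed_closure.
    near=> y => j Mj.
    have [_ _ /(_ y Mj)[Uj _]] := HM j.
    have Wy : W y by near: y.
    have ij : i = j by apply: HW => //; [exists z|exists y].
    rewrite -ij in Mj *; move: Mj; near: y; exact: closed_near.
  near=> y => j Mj; exfalso; apply: ni; exists j, y; split; last by near: y.
  by have [_ _ /(_ y Mj)[]] := HM j.
- move=> i j x Mi Mj; have [W nW HW] := dU x; apply: HW => //; exists x;
    split; try exact: nbhs_singleton.
  + by have [_ _ /(_ x Mi)[]] := HM i.
  + by have [_ _ /(_ x Mj)[]] := HM j.
Unshelve. all: by end_near. Qed.

(** Enlarging the families of one colour after the other, always away from the
    enlarged sets that are disjoint from the set under consideration, does not
    create new intersections. *)
Lemma swelling (I : Type) (col : I -> nat) (n : nat) (A G : I -> set X) :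
  coloured col n A -> conservative A ->
  (forall i, open (G i)) -> (forall i, A i `<=` G i) ->
  exists U : I -> set X,
    [/\ forall i, open (U i), forall i, A i `<=` U i,
        forall i, closure (U i) `<=` G i,
        conservative (fun i => closure (U i))
      & forall i j, closure (U i) `&` closure (U j) !=set0 ->
          A i `&` A j !=set0].
Proof.
move=> [An Ad] cA oG AG.
pose swollen (U : I -> set X) t i := if (col i < t)%N then closure (U i) else A i.
have swell t : exists U : I -> set X,
    [/\ forall i, (col i < t)%N ->
          [/\ open (U i), A i `<=` U i & closure (U i) `<=` G i],
        conservative (swollen U t)
      & forall i j, swollen U t i `&` swollen U t j !=set0 ->
          A i `&` A j !=set0].
  elim: t => [|t [U [HU cU nU]]]; first by exists (fun=> set0); split.
  pose good i := [set z | A i !=set0 /\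
    forall j, swollen U t j z -> swollen U t j `&` A i !=set0].
  have [||||M [oM AM MG cM dM]] := @discrete_expansion I
    (fun i => if col i == t then A i else set0) (fun i => G i `&` (good i)°).
  - by move=> x; apply: filterS (cA x) => y H i; case: ifP => // _ /H.
  - by move=> i j x; do 2!case: eqP => // ?; move=> Ai Aj; apply: (Ad i j x); congruence.
  - by move=> i; apply: openI => //; exact: open_interior.
  - move=> i x; case: eqP => // it Ax; split; first exact: AG.
    apply: filterS (cU x) => y H; split; first by exists x.
    by move=> j /H Ux; exists x.
  exists (fun i => if col i == t then M i else U i).
  have E i : swollen (fun i => if col i == t then M i else U i) t.+1 i =
      if col i == t then closure (M i) else swollen U t i.
    by rewrite /swollen ltnS; case: (ltngtP (col i) t).
  have nM i j : col i = t -> swollen U t j `&` closure (M i) !=set0 ->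
      A i `&` A j !=set0.
    move=> it [z [Uz /MG[_ /interior_subset[_ /(_ j Uz)[w [Uw Aw]]]]]].
    by apply: nU; exists w; split => //; rewrite /swollen it ltnn.
  split.
  - move=> i; rewrite ltnS leq_eqVlt; case: eqP => //= [it _|_ /HU//].
    split=> //; first by have := AM i; rewrite it eqxx.
    by move=> x /MG[].
  - move=> x; near=> y => i; rewrite !E; case: eqP => _.
      by move: i; near: y; exact: cM.
    by move: i; near: y; exact: cU.
  - move=> i j; rewrite !E; case: eqP => it; case: eqP => jt.
    + move=> [x [Mi Mj]]; rewrite (dM _ _ _ Mj Mi) setIid.
      by have [_ /interior_subset[]] := MG _ _ Mi.
    + by rewrite setIC; exact: nM.
    + by move=> /(nM _ _ jt); rewrite setIC.
    + exact: nU.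
have [U [HU cU nU]] := swell n.
(* Indices whose colour is not below [n] have empty sets. *)
pose V i := if (col i < n)%N then U i else set0.
have VE i : closure (V i) = swollen U n i.
  rewrite /V /swollen; case: ltnP => // ni; rewrite closure0; apply/esym.
  apply/seteqP; split => // x Ax.
  by have := An i; rewrite ltnNge ni => H; have := H (ex_intro _ x Ax).
exists V; split.
- by move=> i; rewrite /V; case: ifP => [/HU[]//|_]; exact: open0.
- move=> i x Ax; have ni : (col i < n)%N by apply: An; exists x.
  by rewrite /V ni; have [_ + _] := HU i ni; exact.
- by move=> i; rewrite VE /swollen; case: ifP => [/HU[]//|_]; exact: AG.
- by move=> x; apply: filterS (cU x) => y H i; rewrite !VE; exact: H.
- by move=> i j; rewrite !VE; exact: nU.
Unshelve. all: by end_near. Qed.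

End collectionwise_normal.

(** * Cells around the strata of a closed set *)

Section cells.
Variable X : topologicalType.
Hypothesis cwnX : collectionwise_normal X.
Variables (I : Type) (col : I -> nat) (n : nat) (A V : I -> set X).
Hypotheses (colA : coloured col n A) (cA : conservative A).
Hypotheses (oV : forall i, open (V i)) (AV : forall i, A i `<=` V i).
Variables (D : set X) (T : Type) (H : X -> T).
Hypotheses (cD : closed D).
Hypothesis locH : forall x, D x -> \forall y \near x, D y -> H y = H x.

Local Notation deg := (degree col n A).

(** The centers [u] in [Q] index the cells that cover the points of [D] of
    degree at least [j], at most one for each type and label; the cells of
    other indices are empty.  The label [H], locally constant on [D], will be the
    set of those members of the network that contain a point. *)
Record cells (j : nat) (Q : set X) (M : X -> set X) : Prop := Cells {
  cells_center : forall u, Q u -> [/\ D u, M u u & (j <= deg u)%N];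
  cells_open : forall u, open (M u);
  cells_index : forall u, M u !=set0 -> Q u;
  cells_conservative : conservative (fun u => closure (M u));
  cells_disjoint : forall u v x, closure (M u) x -> closure (M v) x ->
    deg u = deg v -> u = v;
  cells_type : forall u x i, closure (M u) x -> A i x -> A i u;
  cells_near : forall u x i, closure (M u) x -> A i u -> V i x;
  cells_label : forall u x, closure (M u) x -> D x -> H x = H u;
  cells_chain : forall u v x i, closure (M u) x -> closure (M v) x ->
    (deg u <= deg v)%N -> A i u -> A i v;
  cells_avoid : forall u v, Q u -> M v u -> (deg u <= deg v)%N -> u = v;
  cells_inj : forall u v, Q u -> Q v -> A^~ u = A^~ v -> H u = H v -> u = v;
  cells_cover : forall x, D x -> (j <= deg x)%N -> exists u, M u x
}.

Lemma closure_nonempty (B : set X) x : closure B x -> B !=set0.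
Proof. by move=> /(_ setT filterT)[y []]; exists y. Qed.

Lemma cells_closure_index j Q M u x : cells j Q M -> closure (M u) x -> Q u.
Proof. by move=> CM /closure_nonempty /(cells_index CM). Qed.

Lemma deg_type u v : A^~ u = A^~ v -> deg u = deg v.
Proof.
move=> uv; have E i : A i u = A i v by rewrite -[LHS]/((A^~ u) i) uv.
by apply/eqP; rewrite eqn_leq !degree_sub// => i; rewrite E.
Qed.

(** The points of degree [j] outside the cells of higher degree fall into a
    discrete family of closed sets according to type and label, since near such
    a point the type can only decrease.  A cell of higher degree whose closure
    contains one of these points has a greater type; the others can be avoided,
    because the family of closures is conservative. *)
Lemma cells_step j Q M : cells j.+1 Q M -> exists Q' M', cells j Q' M'.
Proof.
move=> CM.
pose Y := [set x | [/\ D x, (j <= deg x)%N & forall u, ~ M u x]].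
pose key x := (A^~ x, H x).
(* The representative of the class of [x]; it does not depend on [x] because
   the default value of [xget] is used for the empty set only. *)
pose rep x := xget x [set y | Y y /\ key y = key x].
have repP x : Y x -> Y (rep x) /\ key (rep x) = key x.
  by move=> Yx; apply: (@xgetPex _ x [set y | Y y /\ key y = key x]); exists x.
have repE x y : Y x -> key x = key y -> rep x = rep y.
  move=> Yx xy; rewrite /rep -xy /xget.
  by case: pselect => // -[]; exists x; apply/asboolP.
have degY x : Y x -> deg x = j.
  move=> [Dx jx nM]; apply/eqP; rewrite eqn_leq jx andbT leqNgt; apply/negP => ltj.
  by have [u /nM] := cells_cover CM Dx ltj.
have Ynear x : \forall y \near x, Y y -> Y x /\ key y = key x.
  have [[u Mu]|nM] := pselect (exists u, M u x).
    have : nbhs x (M u) by apply: open_nbhs_nbhs; split => //; exact: (cells_open CM u).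
    by apply: filterS => y My [_ _ /(_ u)].
  have [Dx|nDx] := pselect (D x); last first.
    by apply: filterS (closed_near x cD) => y + [Dy _ _] => /(_ Dy).
  near=> y => Yy.
  have Ayx i : A i y -> A i x by move: i; near: y; exact: cA.
  have dyx : (deg y <= deg x)%N by exact: degree_sub.
  have Yx : Y x.
    split=> //; first by rewrite -(degY y).
    by move=> u Mu; apply: nM; exists u.
  split=> //; congr (_, _); last first.
    by have [Dy _ _] := Yy; move: Dy; near: y; exact: locH.
  apply/funext => i; apply/propext; split; first exact: Ayx.
  by apply: (degree_eq colA) => //; rewrite (degY x)// (degY y).
pose Z u := [set x | Y x /\ rep x = u].
pose good u z := [/\ Z u !=set0, forall i, A i z -> A i u,
  forall i, A i u -> V i z, D z -> H z = H u
  & forall v, closure (M v) z -> forall i, A i u -> A i v].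
have Zkey u x : Z u x -> key u = key x by move=> [/repP[_ <-] ->].
have ZA u x : Z u x -> A^~ u = A^~ x by move=> /Zkey[].
have ZAE u x i : Z u x -> A i u = A i x.
  by move=> /ZA ux; rewrite -[LHS]/((A^~ u) i) ux.
have [||||M' [oM' ZM' M'good cM' dM']] :=
  @discrete_expansion X cwnX X Z (fun u => [set z | good u z]°).
- move=> x; apply: filterS (Ynear x) => y Hy u [Yy ru]; have [Yx yx] := Hy Yy.
  by split => //; rewrite -ru; apply: repE => //; rewrite yx.
- by move=> u v x [_ <-] [_ <-].
- by move=> u; exact: open_interior.
- move=> u x Zux; have [Yx _] := Zux; have [Dx _ _] := Yx.
  rewrite /interior /=; near=> z; split.
  + by exists x.
  + move=> i; rewrite (ZAE _ _ _ Zux); move: i; near: z; exact: cA.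
  + move=> i; rewrite (ZAE _ _ _ Zux); move: i; near: z.
    apply: (coloured_near_forall colA) => i Ai.
    by apply: open_nbhs_nbhs; split; [exact: oV|exact: AV].
  + by have [_ ->] := Zkey _ _ Zux; near: z; exact: locH.
  + move=> v Mvz i; rewrite (ZAE _ _ _ Zux) => Ai; apply: (cells_type CM) Ai.
    by move: v Mvz; near: z; exact: (cells_conservative CM).
have {}M'good u z : closure (M' u) z -> good u z.
  by move=> /M'good /interior_subset.
have ZY u : Z u !=set0 -> Y u by move=> [x [/repP[? _] <-]].
have ZZ u : Z u !=set0 -> Z u u.
  move=> [x [Yx <-]]; have [Yr rx] := repP x Yx.
  by split => //; apply: repE.
have M'Y u z : closure (M' u) z -> Y u /\ deg u = j.
  by move=> /M'good[/ZY Yu _ _ _ _]; split => //; exact: degY.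
have Mj u z : closure (M u) z -> (j < deg u)%N.
  by move=> /(cells_closure_index CM) /(cells_center CM)[].
exists (Q `|` [set u | Z u !=set0]), (fun u => M u `|` M' u).
have clU u z : closure (M u `|` M' u) z -> closure (M u) z \/ closure (M' u) z.
  by rewrite closureU.
split.
- move=> u [/(cells_center CM)[Du Mu ju]|Zu].
    by split => //; [left|exact: ltnW].
  by have [Du ju _] := ZY _ Zu; split => //; right; exact/ZM'/ZZ.
- by move=> u; apply: openU => //; exact: (cells_open CM u).
- move=> u [x [Mu|M'u]]; first by left; apply: (cells_index CM); exists x.
  by right; have [] := M'good u x (subset_closure M'u).
- move=> x; near=> y => u; rewrite !closureU => -[Mu|Mu]; [left|right].
    by move: u Mu; near: y; exact: (cells_conservative CM x).
  by move: u Mu; near: y; exact: cM'.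
- move=> u v x /clU[Mu|Mu] /clU[Mv|Mv] uv.
  + exact: (cells_disjoint CM Mu Mv uv).
  + by have := Mj _ _ Mu; have [_ vj] := M'Y _ _ Mv; rewrite uv vj ltnn.
  + by have := Mj _ _ Mv; have [_ vj] := M'Y _ _ Mu; rewrite -uv vj ltnn.
  + exact: dM' Mu Mv.
- move=> u x i /clU[Mu|/M'good[_ + _ _ _]]; last exact.
  exact: (cells_type CM Mu).
- move=> u x i /clU[Mu|/M'good[_ _ + _ _]]; last exact.
  exact: (cells_near CM Mu).
- move=> u x /clU[Mu|/M'good[_ _ _ + _]]; last exact.
  exact: (cells_label CM Mu).
- move=> u v x i /clU[Mu|Mu] /clU[Mv|Mv] uv.
  + exact: (cells_chain CM Mu Mv uv).
  + have := Mj _ _ Mu; have [_ vj] := M'Y _ _ Mv.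
    by rewrite -vj ltnNge uv.
  + by have [_ _ _ _] := M'good _ _ Mu; apply.
  + by rewrite (dM' _ _ _ Mu Mv).
- move=> u v [Qu|Zu] [Mv|Mv] uv.
  + exact: (cells_avoid CM Qu Mv uv).
  + have [_ _] := cells_center CM Qu.
    have [_ vj] := M'Y v u (subset_closure Mv).
    by rewrite -vj ltnNge uv.
  + by have [_ _ /(_ v)] := ZY _ Zu.
  + by apply: dM' (subset_closure _) (subset_closure Mv); exact/ZM'/ZZ.
- move=> u v [Qu|Zu] [Qv|Zv] uv Huv.
  + exact: (cells_inj CM Qu Qv uv Huv).
  + have [_ _] := cells_center CM Qu.
    by rewrite (deg_type uv) (degY _ (ZY _ Zv)) ltnn.
  + have [_ _] := cells_center CM Qv.
    by rewrite -(deg_type uv) (degY _ (ZY _ Zu)) ltnn.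
  + have [_ <-] := ZZ _ Zu; have [_ <-] := ZZ _ Zv.
    by apply: repE; [exact: ZY|rewrite /key uv Huv].
- move=> x Dx jx; have [[u Mu]|nM] := pselect (exists u, M u x).
    by exists u; left.
  have Yx : Y x by split => // u Mu; apply: nM; exists u.
  by exists (rep x); right; apply: ZM'; split.
Unshelve. all: by end_near. Qed.

Lemma cells_exist : exists Q M, cells 0 Q M.
Proof.
have : forall t, exists Q M, cells (n.+1 - t) Q M.
  elim=> [|t [Q [M]]].
    exists set0, (fun=> set0); split=> //; rewrite ?subn0.
    - by move=> u; exact: open0.
    - by move=> u [].
    - by move=> x; apply: nearW => y u; rewrite closure0.
    - by move=> u v x; rewrite closure0.
    - by move=> u x i; rewrite closure0.
    - by move=> u x i; rewrite closure0.
    - by move=> u x; rewrite closure0.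
    - by move=> u v x i; rewrite closure0.
    - by move=> x _; rewrite ltnNge degree_le.
  have [tn|nt] := ltnP t n.+1.
    by rewrite -[(n.+1 - t)%N](@ltn_predK 0) ?subn_gt0// -subnS; exact: cells_step.
  have -> : (n.+1 - t.+1 = n.+1 - t)%N.
    by apply/eqP; rewrite subnS; move: nt; rewrite -subn_eq0 => /eqP ->.
  by move=> CM; exists Q, M.
by move=> /(_ n.+1); rewrite subnn.
Qed.

End cells.

(** * Binary refinements *)

Lemma distinct_choice (J : finType) (T : eqType) (x0 : T) (W : J -> Prop)
    (P : J -> set T) : (forall j, W j -> infinite_set (P j)) ->
  exists g : J -> T, (forall j, W j -> P j (g j)) /\
    (forall j k, W j -> W k -> g j = g k -> j = k).
Proof.
move=> infP.
suff [g [gP gI]] : exists g : J -> T,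
    (forall j, j \in enum J -> W j -> P j (g j)) /\
    (forall j k, j \in enum J -> k \in enum J -> W j -> W k -> g j = g k -> j = k).
  exists g; split=> [j|j k]; first by apply: gP; rewrite mem_enum.
  by apply: gI; rewrite mem_enum.
elim: (enum J) => [|j s [g [gP gI]]]; first by exists (fun=> x0).
have [js|js] := boolP (j \in s).
  have sub k : k \in j :: s -> k \in s by rewrite inE => /predU1P[->|].
  by exists g; split=> [k /sub|k l /sub ks /sub ls]; [exact: gP|exact: gI].
have [Wj|nWj] := pselect (W j); last first.
  exists g; split=> [k|k l]; rewrite !inE.
    by move=> /predU1P[->//|]; exact: gP.
  by move=> /predU1P[->//|ks] /predU1P[->//|ls]; exact: gI.
have [x [Px nx]] : (P j `\` [set` map g s]) !=set0.
  apply: infinite_setN0; apply: infinite_setD; first exact: infP.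
  exact: finite_seq.
exists (fun k => if k == j then x else g k); split=> [k|k l]; rewrite !inE.
  move=> /predU1P[->|ks]; first by rewrite eqxx.
  by have [kj|_] := eqVneq k j; [rewrite -kj ks in js|exact: gP].
have xs m : m \in s -> x != g m.
  by move=> ms; apply/eqP => xg; apply: nx; rewrite /= xg map_f.
move=> /predU1P[->|ks] /predU1P[->|ls]; rewrite ?eqxx//.
- have [//|_ _ _ /eqP] := eqVneq l j; rewrite (negPf (xs _ ls))//.
- have [//|_ _ _ /eqP] := eqVneq k j; rewrite eq_sym (negPf (xs _ ks))//.
- have [kj|_] := eqVneq k j; first by rewrite -kj ks in js.
  have [lj|_] := eqVneq l j; first by rewrite -lj ls in js.
  exact: gI.
Qed.

Lemma limit_point_infinite (X : topologicalType) (B P : set X) x :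
  accessible_space X -> closure B x -> ~ B x -> nbhs x P ->
  infinite_set (B `&` P).
Proof.
move=> T1 clB nB nP fin.
have cF : closed (B `&` P) by exact: (accessible_finite_set_closed.1 T1).
have nF : nbhs x (~` (B `&` P)).
  by apply: open_nbhs_nbhs; split; [exact: closed_openC|move=> []].
by have [y [By [Py []]]] := clB _ (filterI nP nF).
Qed.

Section refinement.
Variable X : topologicalType.
Hypothesis cwnX : collectionwise_normal X.
Variables (I : Type) (col : I -> nat) (n : nat) (A V : I -> set X).
Hypotheses (colA : coloured col n A) (cA : conservative A).
Hypotheses (oV : forall i, open (V i)) (AV : forall i, A i `<=` V i).
Hypothesis nerveV : forall i j, V i `&` V j !=set0 -> A i `&` A j !=set0.
Hypothesis binA : forall S : set I, S !=set0 ->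
  (forall i j, S i -> S j -> A i `&` A j !=set0) ->
  exists x, forall i, S i -> A i x.
Variables (D : set X) (T : Type) (H : X -> T).
Hypotheses (cD : closed D).
Hypothesis locH : forall x, D x -> \forall y \near x, D y -> H y = H x.

Local Notation deg := (degree col n A).

(** [E] is the family of the new pieces of [D], and [A'] is the old family
    with points of [D] added. *)
Record refinement (E : X -> set X) (A' : I -> set X) : Prop := Refinement {
  refinement_sub : forall i, A i `<=` A' i;
  refinement_bound : forall i x, A' i x -> A i x \/ D x;
  refinement_near : forall i, A' i `<=` V i;
  refinement_conservative : conservative A';
  refinement_conservative_new : conservative E;
  refinement_label : forall u x, E u x -> [/\ D u, D x & H x = H u];
  refinement_cover : forall x, D x -> exists u, E u x;
  refinement_disjoint : forall u v x, E u x -> E v x -> deg u = deg v -> u = v;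
  refinement_binary : forall (S : set I) (L : set X), S !=set0 \/ L !=set0 ->
    (forall i j, S i -> S j -> A' i `&` A' j !=set0) ->
    (forall i u, S i -> L u -> A' i `&` E u !=set0) ->
    (forall u v, L u -> L v -> E u `&` E v !=set0) ->
    exists x, (forall i, S i -> A' i x) /\ (forall u, L u -> E u x)
}.

Section pieces.
Variables (Q : set X) (M : X -> set X).
Hypothesis CM : cells col n A V D H 0 Q M.

(** Trimming by the cells of higher degree makes the kernels disjoint; their
    closures still cover [D], because near each point of [D] some cell of the
    greatest degree there is not trimmed at all. *)
Definition kernel u := [set z | [/\ D z, M u z &
  forall v, (deg u < deg v)%N -> ~ closure (D `&` M v) z]].

(** The center is put back because trimming may have removed all points of the
    type of [u]. *)
Definition piece u := closure (kernel u) `|` [set x | Q u /\ x = u].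

Lemma piece_cell u x : piece u x -> closure (M u) x.
Proof.
move=> [|[Qu ->]]; first by apply: closureS => y [].
by apply: subset_closure; have [] := cells_center CM Qu.
Qed.

Lemma piece_sub u x : piece u x -> D x.
Proof.
move=> [clx|[Qu ->]]; last by have [] := cells_center CM Qu.
by apply: cD; apply: closureS clx => y [].
Qed.

Lemma piece_index u x : piece u x -> Q u.
Proof. by move=> /piece_cell /(cells_closure_index CM). Qed.

Lemma piece_closed u : closed (piece u).
Proof.
apply: closedU; first exact: closed_closure.
apply: (accessible_finite_set_closed.1 cwnX.1).
by apply: (@sub_finite_set _ _ [set u]) => [x []|]; [|exact: finite_set1].
Qed.

Lemma piece_center u : Q u -> piece u u.
Proof. by move=> Qu; right. Qed.

Lemma coloured_cells : coloured deg n.+1 (fun u => closure (M u)).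
Proof.
split=> [u _|u v x]; first by rewrite ltnS degree_le.
exact: (cells_disjoint CM).
Qed.

Lemma piece_conservative : conservative piece.
Proof.
apply: (coloured_closed_sub coloured_cells).
- exact: cells_conservative CM.
- by move=> u x; exact: piece_cell.
- exact: piece_closed.
Qed.

Lemma piece_cover x : D x -> exists u, piece u x.
Proof.
move=> Dx.
pose P k := `[< exists2 v, closure (D `&` M v) x & deg v = k >].
have exP : exists k, P k.
  have [u Mu] := cells_cover CM Dx (leq0n _).
  exists (deg u); apply/asboolP; exists u => //.
  exact: subset_closure.
have leP k : P k -> (k <= n)%N.
  by move=> /asboolP[v _ <-]; exact: degree_le.
have [k /asboolP[v clv <-] maxv] := ex_maxnP exP leP.
exists v; left => W nW.
have near_cells : \forall z \near x, forall w,
    closure (D `&` M w) z -> closure (D `&` M w) x.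
  apply: (coloured_closed_sub coloured_cells).
  - exact: cells_conservative CM.
  - by move=> u; apply: closureS => y [].
  - by move=> u; exact: closed_closure.
have [z [[Dz Mz] [Wz Hz]]] := clv _ (filterI nW near_cells).
exists z; split=> //; split=> // w vw /Hz clw.
have : P (deg w) by apply/asboolP; exists w.
by move=> /maxv; rewrite leqNgt vw.
Qed.

(** Points of a kernel are private to its piece: pieces of higher degree have
    been trimmed away, and those of lower degree have been trimmed by the cell
    that contains the kernel. *)
Lemma kernel_piece u v x : kernel u x -> piece v x -> u = v.
Proof.
move=> [Dx Mu nu] pv.
have [uv|vu|uv] := ltngtP (deg u) (deg v).
- exfalso; apply: (nu v uv); case: pv => [|[Qv ->]].
    by apply: closureS => y [].
  by apply: subset_closure; have [] := cells_center CM Qv.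
- case: pv => [clv|[Qv xv]]; last first.
    by apply/esym; apply: (cells_avoid CM Qv); rewrite -?xv// xv ltnW.
  have nM : nbhs x (M u) by apply: open_nbhs_nbhs; split => //; exact: cells_open CM u.
  have [y [[Dy My ny] My']] := clv _ nM.
  by exfalso; apply: (ny u vu); exact: subset_closure.
- apply: (cells_disjoint CM) uv; last exact: piece_cell pv.
  exact: subset_closure.
Qed.

Lemma kernel_sub u x : kernel u x -> piece u x.
Proof. by move=> ku; left; exact: subset_closure. Qed.

Lemma piece_chain u v : piece u `&` piece v !=set0 -> (deg u <= deg v)%N ->
  forall i, A i u -> A i v.
Proof.
by move=> [x [pu pv]] uv i; exact: (cells_chain CM (piece_cell pu) (piece_cell pv)).
Qed.

Lemma piece_disjoint u v : piece u `&` piece v !=set0 -> deg u = deg v -> u = v.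
Proof.
by move=> [x [pu pv]]; exact: (cells_disjoint CM (piece_cell pu) (piece_cell pv)).
Qed.

Lemma piece_label u v : piece u `&` piece v !=set0 -> H u = H v.
Proof.
move=> [x [pu pv]]; rewrite -(cells_label CM (piece_cell pu) (piece_sub pu)).
exact: (cells_label CM (piece_cell pv) (piece_sub pv)).
Qed.

(** A common point of the two pieces is a limit of the kernel of [u] without
    belonging to it, and in a T1 space every neighbourhood of such a limit has
    infinitely many points of the kernel. *)
Lemma kernel_infinite u v : piece u `&` piece v !=set0 -> (deg v < deg u)%N ->
  infinite_set (kernel u `&` [set p | (forall i, A i p -> A i v) /\
                                      (forall i, A i v -> V i p)]).
Proof.
move=> [q [pu pv]] vu.
have nku : ~ kernel u q by move=> /kernel_piece /(_ pv) uv; rewrite uv ltnn in vu.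
have clu : closure (kernel u) q.
  case: pu => // -[Qu qu]; exfalso; move: vu; rewrite ltnNge => /negP; apply.
  apply: degree_sub => i Ai; apply: (cells_type CM (piece_cell pv)).
  by rewrite qu.
apply: limit_point_infinite (cwnX.1) clu nku _.
near=> p; split.
  move=> i Ai; apply: (cells_type CM (piece_cell pv)).
  by move: i Ai; near: p; exact: cA.
near: p; apply: (coloured_near_forall colA) => i Ai.
apply: open_nbhs_nbhs; split; first exact: oV.
exact: (cells_near CM (piece_cell pv)).
Unshelve. all: by end_near. Qed.

Local Notation code := {set {set 'I_n}}.

(** A linked family of pieces with greatest center [u] is coded by the set [J]
    of the sets of colours of its centers ([chain_below_code]); the codes form a
    finite type. *)
Definition chain_below u (J : code) := [set v | [/\ Q v, colours col n A v \in J,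
  forall i, A i v -> A i u & H v = H u]].

Definition valid u (J : code) := [/\ chain_below u J u,
  forall v w, chain_below u J v -> chain_below u J w -> piece v `&` piece w !=set0
  & exists2 v, chain_below u J v & v <> u].

Definition candidate u (J : code) := kernel u `&`
  [set p | (forall v, chain_below u J v -> forall i, A i p -> A i v) /\
           (forall i, (forall v, chain_below u J v -> A i v) -> V i p)].

Lemma chain_below_deg u J v w : valid u J ->
  chain_below u J v -> chain_below u J w -> (deg v <= deg w)%N ->
  forall i, A i v -> A i w.
Proof. by move=> [_ lk _] Lv Lw; apply: piece_chain; exact: lk. Qed.

(** The center of the smallest degree in the chain has the smallest type, so
    that only this one and [u] matter. *)
Lemma candidate_infinite u J : valid u J -> infinite_set (candidate u J).
Proof.
move=> VJ; have [Lu lk [v0 Lv0 v0u]] := VJ.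
pose P k := `[< exists2 v, chain_below u J v & deg v = k >].
have exP : exists k, P k by exists (deg u); apply/asboolP; exists u.
have [k /asboolP[w Lw <-] minw] := ex_minnP exP.
have {}minw v : chain_below u J v -> (deg w <= deg v)%N.
  by move=> Lv; apply: minw; apply/asboolP; exists v.
have wu : (deg w < deg u)%N.
  rewrite ltn_neqAle minw// andbT; apply/eqP => wu; apply: v0u.
  apply: piece_disjoint; first exact: lk.
  apply/eqP; rewrite eqn_leq -{2}wu minw// andbT.
  by apply: degree_sub; have [] := Lv0.
apply: sub_infinite_set (kernel_infinite (lk _ _ Lu Lw) wu).
move=> p [kp [pw Vp]]; split=> //; split.
  move=> v Lv i /pw; apply: (chain_below_deg VJ) => //; exact: minw.
by move=> i Ai; apply: Vp; exact: Ai.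
Qed.

Lemma chain_below_code u (L : set X) : L u ->
  (forall v, L v -> (deg v <= deg u)%N) ->
  (forall v w, L v -> L w -> piece v `&` piece w !=set0) ->
  exists J : code, chain_below u J = L.
Proof.
move=> Lu maxu lk.
have QL v : L v -> Q v.
  by move=> Lv; have [x [pv _]] := lk _ _ Lv Lv; exact: piece_index pv.
have uL v : L v -> forall i, A i v -> A i u.
  by move=> Lv; apply: piece_chain (maxu _ Lv); exact: lk.
have HL v : L v -> H v = H u by move=> Lv; apply: piece_label; exact: lk.
exists ([set c | `[< exists2 v, L v & colours col n A v = c >]]%SET).
apply/seteqP; split=> [w [Qw]|v Lv]; last first.
  split; [exact: QL| |exact: uL|exact: HL].
  by rewrite inE; apply/asboolP; exists v.
rewrite inE => /asboolP[v Lv cvw] wu Hw.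
suff -> : w = v by [].
apply: (cells_inj CM) => //; first exact: QL.
  apply/funext => i; apply/propext; split.
    by apply: (colours_inj colA wu (uL _ Lv)); rewrite cvw.
  by apply: (colours_inj colA (uL _ Lv) wu); rewrite cvw.
by rewrite Hw HL.
Qed.

Section added_points.
Variable p : X -> code -> X.
Hypothesis pP : forall u J, valid u J -> candidate u J (p u J).
Hypothesis p_inj : forall u J K, valid u J -> valid u K -> p u J = p u K -> J = K.

Definition new_piece v := piece v `|`
  [set x | exists u J, [/\ valid u J, chain_below u J v & x = p u J]].

Definition new_member i := A i `|` [set x | exists u J,
  [/\ valid u J, forall v, chain_below u J v -> A i v & x = p u J]].

Lemma added_kernel u J : valid u J -> kernel u (p u J).
Proof. by move=> /pP[]. Qed.

Lemma added_eq u v J K : valid u J -> valid v K -> p u J = p v K ->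
  u = v /\ J = K.
Proof.
move=> VJ VK E; have uv : u = v.
  apply: (kernel_piece (added_kernel VJ)); rewrite E.
  exact/kernel_sub/added_kernel.
by split=> //; move: VK E; rewrite -uv; exact: p_inj.
Qed.

(** The added points are conservative as a family of singletons, since near a
    given point they come from finitely many cells, and finitely many from each
    of these. *)
Lemma added_near x : \forall y \near x,
  forall u J, valid u J -> y = p u J -> x = p u J.
Proof.
near=> y => u J VJ E.
have clMy : closure (M u) y.
  by rewrite E; apply: piece_cell; apply: kernel_sub; exact: added_kernel.
have clMx : closure (M u) x by apply: (near (cells_conservative CM x) y).
move: u clMx J VJ E {clMy}; near: y.
apply: (coloured_near_forall coloured_cells) => u clMx.
apply: filter_forall => J.
have cp : closed [set p u J] by exact: (accessible_closed_set1 cwnX.1).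
by apply: filterS (closed_near x cp) => y H' _ /H' ->.
Unshelve. all: by end_near. Qed.

(** If an added point lies in two new pieces, both are in its chain, because
    it is private to the greatest piece and distinct from the points added for
    other chains. *)
Lemma new_piece_link v w : new_piece v `&` new_piece w !=set0 ->
  piece v `&` piece w !=set0.
Proof.
move=> [x [[pv|[u [J [VJ Lv E]]]] [pw|[u' [K [VK Lw E']]]]]].
- by exists x.
- have uv : u' = v by apply: (kernel_piece (added_kernel VK)); rewrite -E'.
  by have [Lu lk _] := VK; apply: lk => //; rewrite -uv.
- have uw : u = w by apply: (kernel_piece (added_kernel VJ)); rewrite -E.
  by have [Lu lk _] := VJ; apply: lk => //; rewrite -uw.
- have [|uu' JK] := added_eq VJ VK; first by rewrite -E.
  by have [_ lk _] := VJ; apply: lk => //; rewrite uu' JK.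
Qed.

(** The type of an added point is contained in all types of its chain. *)
Lemma new_member_piece i v : new_member i `&` new_piece v !=set0 -> A i v.
Proof.
move=> [x [[Ai|[u [J [VJ Li E]]]] [pv|[u' [K [VK Lv E']]]]]].
- exact: (cells_type CM (piece_cell pv)).
- by have [_ [ty _]] := pP VK; apply: (ty v Lv); rewrite -E'.
- have uv : u = v by apply: (kernel_piece (added_kernel VJ)); rewrite -E.
  by have [Lu _ _] := VJ; rewrite -uv; exact: Li.
- have [|uu' JK] := added_eq VJ VK; first by rewrite -E.
  by apply: Li; rewrite uu' JK.
Qed.

Lemma new_member_near i : new_member i `<=` V i.
Proof.
move=> x [|[u [J [VJ Li ->]]]]; first exact: AV.
by have [_ [_]] := pP VJ; apply.
Qed.

(** For at least two pieces the common point is the one added for their chain;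
    for a single piece it is the center. *)
Lemma new_binary (S : set I) (L : set X) : S !=set0 \/ L !=set0 ->
  (forall i j, S i -> S j -> new_member i `&` new_member j !=set0) ->
  (forall i u, S i -> L u -> new_member i `&` new_piece u !=set0) ->
  (forall u v, L u -> L v -> new_piece u `&` new_piece v !=set0) ->
  exists x, (forall i, S i -> new_member i x) /\ (forall u, L u -> new_piece u x).
Proof.
move=> SL lSS lSL lLL.
have [[u0 Lu0]|nL] := pselect (L !=set0); last first.
  have [|i j Si Sj|x Hx] := binA (S := S).
  - by case: SL.
  - apply: nerveV; have [x [Ai Aj]] := lSS _ _ Si Sj.
    by exists x; split; exact: new_member_near.
  - exists x; split=> [i /Hx|u Lu]; first by left.
    by exfalso; apply: nL; exists u.
pose P k := `[< exists2 v, L v & deg v = k >].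
have exP : exists k, P k by exists (deg u0); apply/asboolP; exists u0.
have leP k : P k -> (k <= n)%N.
  by move=> /asboolP[v _ <-]; exact: degree_le.
have [k /asboolP[u Lu <-] maxu] := ex_maxnP exP leP.
have {}maxu v : L v -> (deg v <= deg u)%N.
  by move=> Lv; apply: maxu; apply/asboolP; exists v.
have SA i v : S i -> L v -> A i v.
  by move=> Si Lv; apply: new_member_piece; exact: lSL.
have pu : piece u u.
  by have [x [px _]] := new_piece_link (lLL _ _ Lu Lu);
    apply: piece_center; exact: piece_index px.
have [[v Lv vu]|only] := pselect (exists2 v, L v & v <> u); last first.
  exists u; split=> [i Si|v Lv]; first by left; exact: SA.
  have [->|vu] := pselect (v = u); first by left.
  by exfalso; apply: only; exists v.
have lk v' w : L v' -> L w -> piece v' `&` piece w !=set0.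
  by move=> Lv' Lw; apply: new_piece_link; exact: lLL.
have [J LJ] := chain_below_code Lu maxu lk.
have VJ : valid u J by split; rewrite LJ//; exists v.
exists (p u J); split=> [i Si|w Lw]; right; exists u, J; split=> //.
  by move=> w; rewrite LJ; exact: SA.
by rewrite LJ.
Qed.

Lemma new_refinement : refinement new_piece new_member.
Proof.
split.
- by move=> i x; left.
- move=> i x [|[u [J [VJ _ ->]]]]; [by left|right].
  by have [[]] := pP VJ.
- exact: new_member_near.
- move=> x; near=> y => i [Ai|[u [J [VJ Li E]]]].
    by left; move: i Ai; near: y; exact: cA.
  right; exists u, J; split=> //.
  by move: u J VJ E {Li}; near: y; exact: added_near.
- move=> x; near=> y => v [pv|[u [J [VJ Lv E]]]].
    by left; move: v pv; near: y; exact: piece_conservative.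
  right; exists u, J; split=> //.
  by move: u J VJ E {Lv}; near: y; exact: added_near.
- move=> v x [pv|[u [J [VJ Lv E]]]].
    have [Dv _ _] := cells_center CM (piece_index pv).
    split=> //; first exact: piece_sub pv.
    exact: (cells_label CM (piece_cell pv) (piece_sub pv)).
  have [Qv _ _ Hv] := Lv; have [Dv _ _] := cells_center CM Qv.
  have ku := added_kernel VJ; have pu := kernel_sub ku.
  rewrite E; split=> //; first exact: piece_sub pu.
  by rewrite Hv; exact: (cells_label CM (piece_cell pu) (piece_sub pu)).
- by move=> x /piece_cover[u pu]; exists u; left.
- move=> u v x pu pv; apply: piece_disjoint; apply: new_piece_link.
  by exists x.
- exact: new_binary.
Unshelve. all: by end_near. Qed.

End added_points.

End pieces.

Lemma refinement_exists : exists E A', refinement E A'.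
Proof.
have [Q [M CM]] := cells_exist cwnX colA cA oV AV cD locH.
have /choice[p Hp] : forall u, exists g : {set {set 'I_n}} -> X,
    (forall J, valid Q M u J -> candidate Q M u J (g J)) /\
    (forall J K, valid Q M u J -> valid Q M u K -> g J = g K -> J = K).
  by move=> u; apply: (distinct_choice u) => J; exact: candidate_infinite.
exists (new_piece Q M p), (new_member Q M p).
by apply: new_refinement => // u; have [] := Hp u.
Qed.

End refinement.

(** * Construction of the binary network by stages *)

Section construction.
Variable X : topologicalType.
Hypothesis cwnX : collectionwise_normal X.
Variable N : nat -> set_system X.
Hypothesis closedN : forall l, N l `<=` closed.
Hypothesis discreteN : forall l, discrete_family (N l) id.

Definition signature m (lC : nat * set X) : set X :=
  [set x | [/\ (lC.1 < m)%N, N lC.1 lC.2 & lC.2 x]].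

Lemma member_unique l B C x : N l B -> N l C -> B x -> C x -> B = C.
Proof.
move=> NB NC Bx Cx; have [W nW HW] := discreteN l x.
by apply: HW => //; exists x; split => //; exact: nbhs_singleton.
Qed.

Lemma signature_coloured m : coloured fst m (signature m).
Proof.
split=> [i [x []]//|[k B] [l C] x [/= _ NB Bx] [/= _ NC Cx] /= kl].
by rewrite kl in NB *; rewrite (member_unique NB NC Bx Cx).
Qed.

Lemma signature_conservative m : conservative (signature m).
Proof.
move=> x.
have : \forall y \near x, forall l : 'I_m, forall C, N l C /\ C y -> N l C /\ C x.
  apply: filter_forall => l.
  by apply: (discrete_conservative (discreteN l)) => C; exact: closedN.
apply: filterS => y H [l C] [/= lm NC Cy]; split => //=.
by have [] := H (Ordinal lm) C (conj NC Cy).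
Qed.

(** An index is a colour together with a center; members with a colour that is
    not below [size_of] are empty. *)
Record stage := Stage {
  size_of : nat;
  member : nat * X -> set X;
  hull : nat * X -> set X;
  bound : nat * X -> set X
}.

Record good_stage (m : nat) (s : stage) : Prop := GoodStage {
  stage_coloured : coloured fst (size_of s) (member s);
  stage_conservative : conservative (member s);
  stage_open : forall i, open (hull s i);
  stage_hull : forall i, member s i `<=` hull s i;
  stage_nerve : forall i j, hull s i `&` hull s j !=set0 ->
    member s i `&` member s j !=set0;
  stage_binary : forall S : set (nat * X), S !=set0 ->
    (forall i j, S i -> S j -> member s i `&` member s j !=set0) ->
    exists x, forall i, S i -> member s i x;
  stage_bound : forall i, member s i `<=` bound s i;
  stage_source : forall i, member s i !=set0 ->
    exists2 l, (l < m)%N & N l (bound s i)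
}.

(** The closure of the new hull is inside the old one, in order that hulls
    contain the limits of their members. *)
Definition extends (s s' : stage) := (size_of s <= size_of s')%N /\
  forall i, (i.1 < size_of s)%N -> [/\ member s i `<=` member s' i,
    bound s' i = bound s i & closure (hull s' i) `<=` hull s i].

Lemma extends_trans s1 s2 s3 : extends s1 s2 -> extends s2 s3 -> extends s1 s3.
Proof.
move=> [n12 H12] [n23 H23]; split; first exact: leq_trans n12 n23.
move=> i i1; have [m12 b12 h12] := H12 i i1.
have [m23 b23 h23] := H23 i (leq_trans i1 n12).
split; [exact: subset_trans m12 m23|by rewrite b23|].
by move=> x /h23 /subset_closure /h12.
Qed.

Local Notation covered s l x := (exists2 i, member s i x & N l (bound s i)).

Section step.
Variables (l : nat) (s : stage) (D : set X) (k : nat).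
Hypotheses (gs : good_stage l.+1 s) (cD : closed D).
Hypothesis DN : D `<=` \bigcup_(C in N l) C.
Hypothesis degD : forall x, D x -> degree fst l.+1 (signature l.+1) x = k.

Let n := size_of s.
Let A := member s.
Let H x := (signature l.+1)^~ x.
Let deg := degree fst n A.

Lemma step_label x : D x -> \forall y \near x, D y -> H y = H x.
Proof.
move=> Dx; near=> y => Dy.
have yx i : signature l.+1 i y -> signature l.+1 i x.
  by move: i; near: y; exact: signature_conservative.
apply/funext => i; apply/propext; split; first exact: yx.
by apply: (degree_eq (signature_coloured _)) => //; rewrite !degD.
Unshelve. all: by end_near. Qed.

(** On [D] the bounds are locally constant, so that the points of [D] close to
    a member lie in its bound. *)
Let V i := hull s i `&` [set z | D z -> bound s i z]°.

Lemma step_open i : open (V i).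
Proof. by apply: openI; [exact: stage_open gs i|exact: open_interior]. Qed.

Lemma step_hull i : A i `<=` V i.
Proof.
move=> x Ax; split; first exact: (stage_hull gs).
have [|l' ll' NB] := stage_source gs (i := i); first by exists x.
have Bx : bound s i x by exact: (stage_bound gs).
have [Dx|nDx] := pselect (D x); last first.
  by apply: filterS (closed_near x cD) => y + Dy => /(_ Dy).
rewrite /interior /=; near=> y => Dy.
have Hyx : H y = H x by move: Dy; near: y; exact: step_label.
have : H x (l', bound s i) by split.
by rewrite -Hyx => -[].
Unshelve. all: by end_near. Qed.

Lemma step_nerve i j : V i `&` V j !=set0 -> A i `&` A j !=set0.
Proof.
by move=> [x [[hi _] [hj _]]]; apply: (stage_nerve gs); exists x.
Qed.

(** The refinement of [D] is thickened inside the members of [N l] by means of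
    a swelling, which creates no new intersections and makes the pieces cover a
    neighbourhood of [D] in the union of [N l]. *)
Lemma stage_step : exists s' (U : set X), [/\ good_stage l.+1 s', extends s s',
  open U, D `<=` U &
  forall x, U x -> (\bigcup_(C in N l) C) x -> covered s' l x].
Proof.
have [E [A' EA]] := refinement_exists cwnX (stage_coloured gs)
  (stage_conservative gs) step_open step_hull step_nerve (stage_binary gs)
  cD step_label.
have /choice[cof cofP] : forall u, exists C, D u -> N l C /\ C u.
  move=> u; have [/DN[C NC Cu]|nDu] := pselect (D u); first by exists C.
  by exists set0.
pose F i := if (i.1 < n)%N then A' i
            else [set x | i.1 = (n + deg i.2)%N /\ E i.2 x].
(* A new piece has the colour [n + degree of its center], the degree being at
   most [n]. *)
pose n' := (n + n.+1)%N.
pose bnd i := if (i.1 < n)%N then bound s i else cof i.2.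
have A'A i : A' i !=set0 -> A i !=set0.
  move=> [x A'x]; have [|y [Ay _]] := @step_nerve i i; last by exists y.
  by exists x; split; exact: (refinement_near EA).
have FcolF : coloured fst n' F.
  split=> [[c u]|[c u] [d v] x]; rewrite /F /=.
    case: ltnP => [cn _|nc [x [-> _]]]; first exact: ltn_addr.
    by rewrite ltn_add2l ltnS degree_le.
  case: ltnP => cn; case: ltnP => dn.
  - move=> A'i A'j cd; have [|y [Ai Aj]] := @step_nerve (c, u) (d, v).
      by exists x; split; exact: (refinement_near EA).
    by have [_ dA] := stage_coloured gs; exact: dA Ai Aj cd.
  - by move=> _ _ cd; move: dn; rewrite -cd leqNgt cn.
  - by move=> _ _ cd; move: cn; rewrite cd leqNgt dn.
  - move=> [-> Eu] [-> Ev] /addnI duv.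
    by rewrite (refinement_disjoint EA Eu Ev duv).
have Fcons : conservative F.
  move=> x; near=> y => i; rewrite /F; case: ifP => _.
    by move: i; near: y; exact: refinement_conservative EA x.
  move=> [? Ey]; split=> //; move: (i.2) Ey; near: y.
  exact: refinement_conservative_new EA x.
pose G i := if (i.1 < n)%N then hull s i
  else [set z | (\bigcup_(C in N l) C) z -> cof i.2 z]°.
have cofE u x : E u x -> cof u x.
  move=> /(refinement_label EA)[Du Dx Hxu].
  have [NC Cu] := cofP _ Du.
  have : H u (l, cof u) by split.
  by rewrite -Hxu => -[].
have FG i : F i `<=` G i.
  move=> x; rewrite /F /G; case: ifP => _.
    by move=> /(refinement_near EA)[].
  move=> [_ Eu]; have Cx := cofE _ _ Eu; rewrite /interior /=.
  have [Du _ _] := refinement_label EA Eu; have [NC _] := cofP _ Du.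
  apply: filterS (signature_conservative l.+1 x) => y Hy [C NC' Cy].
  have [|/= _ _ Cx'] := Hy (l, C); first by split.
  by rewrite (member_unique NC NC' Cx Cx').
have oG i : open (G i).
  rewrite /G; case: ifP => _; [exact: stage_open gs i|exact: open_interior].
have [U [oU FU UG cU nU]] := swelling cwnX FcolF Fcons oG FG.
pose F2 i := if (i.1 < n)%N then A' i else cof i.2 `&` closure (U i).
have FF2 i : F i `<=` F2 i.
  move=> x Fx; have := FU i x Fx; move: Fx; rewrite /F /F2; case: ifP => // _.
  move=> [_ Ex] Ux; split; first exact: cofE.
  exact: subset_closure.
have F2U i : F2 i `<=` closure (U i).
  move=> x; rewrite /F2; case: ifP => [cn Ax|_ []//].
  by apply: subset_closure; apply: FU; rewrite /F cn.
have nF2 i j : F2 i `&` F2 j !=set0 -> F i `&` F j !=set0.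
  by move=> [x [/F2U Ui /F2U Uj]]; apply: nU; exists x.
have F2col : coloured fst n' F2.
  have [Fn Fd] := FcolF; split=> [i [x Fx]|i j x Fi Fj].
    by have [|y [Fy _]] := nF2 i i; [exists x|apply: Fn; exists y].
  by have [|y [Fi' Fj']] := nF2 i j; [exists x|exact: Fd Fi' Fj'].
have cof_new i : ~~ (i.1 < n)%N -> F2 i !=set0 -> D i.2.
  move=> ni [x Fx]; have [|y [+ _]] := nF2 i i; first by exists x.
  by rewrite /F (negPf ni) => -[_ /(refinement_label EA)[]].
have F2cons : conservative F2.
  move=> x; near=> y => i; have [ni|ni] := boolP (i.1 < n)%N.
    by rewrite /F2 ni; move: i {ni}; near: y; exact: refinement_conservative EA x.
  move=> F2y; have Di : D i.2 by apply: cof_new => //; exists y.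
  move: F2y; rewrite /F2 (negPf ni) => -[Cy Uy]; split; last first.
    by move: i Uy {ni Di Cy}; near: y; exact: cU.
  have [NC _] := cofP _ Di.
  have : signature l.+1 (l, cof i.2) y by split.
  suff /[apply] : signature l.+1 (l, cof i.2) y -> signature l.+1 (l, cof i.2) x.
    by case.
  move: (l, cof i.2); near: y; exact: signature_conservative.
pose G2 i := if (i.1 < n)%N then hull s i else setT.
have oG2 i : open (G2 i).
  by rewrite /G2; case: ifP => _; [exact: stage_open gs i|exact: openT].
have FG2 i : F2 i `<=` G2 i.
  move=> x; rewrite /F2 /G2; case: ifP => // _.
  by move=> /(refinement_near EA)[].
have [V' [oV' FV' VG2 cV' nV']] := swelling cwnX F2col F2cons oG2 FG2.
exists (Stage n' F2 V' bnd), (\bigcup_(i in [set i | ~~ (i.1 < n)%N]) U i).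
split.
- split=> //=.
  + move=> i j [x [Vi Vj]]; apply: nV'; exists x.
    by split; exact: subset_closure.
  + move=> S S0 lS.
    have {}lS i j : S i -> S j -> F i `&` F j !=set0.
      by move=> Si Sj; apply: nF2; exact: lS.
    have new i : S i -> ~~ (i.1 < n)%N -> i.1 = (n + deg i.2)%N.
      move=> Si ni; have [x [+ _]] := lS _ _ Si Si.
      by rewrite /F (negPf ni) => -[].
    have [|i j [Si ni] [Sj nj]|i u [Si ni] Su|u v Su Sv|x [Hx1 Hx2]] :=
      refinement_binary EA (S := [set i | S i /\ (i.1 < n)%N])
        (L := [set u | S ((n + deg u)%N, u)]).
    * have [i Si] := S0; have [ni|ni] := boolP (i.1 < n)%N.
        by left; exists i.
      right; exists i.2; rewrite /= -(new i Si ni).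
      by move: Si; case: (i).
    * by have := lS _ _ Si Sj; rewrite /F ni nj.
    * have := lS _ _ Si Su; rewrite /F ni /= ltnNge leq_addr /=.
      by move=> [x [Ax [_ Ex]]]; exists x.
    * have := lS _ _ Su Sv; rewrite /F /= !ltnNge !leq_addr /=.
      by move=> [x [[_ Eu] [_ Ev]]]; exists x.
    * exists x => i Si; apply: FF2; rewrite /F; case: ifP => ni.
        exact: Hx1.
      have ei := new i Si (negbT ni); split=> //; apply: Hx2 => /=.
      by rewrite -ei; move: Si; case: (i).
  + move=> i x; rewrite /F2 /bnd; case: ifP => [ni A'x|_ []//].
    have [Ax|Dx] := refinement_bound EA A'x; first exact: (stage_bound gs).
    by have [_ /interior_subset] := refinement_near EA A'x; exact.
  + move=> i F2i; rewrite /bnd; case: ifP => ni.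
      apply: (stage_source gs); apply: A'A.
      by move: F2i; rewrite /F2 ni.
    exists l => //; have /cofP[] : D i.2 by apply: cof_new => //; rewrite ni.
    by [].
- split=> /=; first exact: leq_addr.
  move=> i ni; rewrite /F2 /bnd ni; split=> //.
    exact: (refinement_sub EA).
  by have := VG2 i; rewrite /G2 ni.
- by apply: bigcup_open.
- move=> x /(refinement_cover EA)[u Eu].
  exists ((n + deg u)%N, u); first by rewrite /= ltnNge leq_addr.
  by apply: FU; rewrite /F /= ltnNge leq_addr.
- move=> x [i /= ni Ux] Cx.
  have : G i x by apply: UG; exact: subset_closure.
  rewrite /G (negPf ni) => /interior_subset /(_ Cx) cx.
  have F2x : F2 i x.
    by rewrite /F2 (negPf ni); split => //; exact: subset_closure.
  exists i => //=; rewrite /bnd (negPf ni).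
  by have /cofP[] : D i.2 by apply: cof_new => //; exists x.
Unshelve. all: by end_near. Qed.

End step.

Lemma near_closed (B : set X) : (forall x, \forall y \near x, B y -> B x) -> closed B.
Proof. by move=> nB x clx; have [y [By /(_ By)]] := clx _ (nB x). Qed.

Lemma good_stage_weaken l s : good_stage l s -> good_stage l.+1 s.
Proof.
move=> gs; split; try by case: gs.
by move=> i /(stage_source gs)[l' ll' NB]; exists l' => //; exact: ltnW.
Qed.

(** The strata are processed in the order of decreasing degree in the signature;
    outside a neighbourhood of the higher strata, the points of degree at least
    [k] form a closed set on which the degree is constant. *)
Lemma stage_process l s : good_stage l s -> exists s', [/\ good_stage l.+1 s',
  extends s s' & forall x, (\bigcup_(C in N l) C) x -> covered s' l x].
Proof.
move=> /good_stage_weaken gs.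
pose deg := degree fst l.+1 (signature l.+1).
have claim t : exists s' (U : set X), [/\ good_stage l.+1 s', extends s s', open U,
    forall x, (\bigcup_(C in N l) C) x -> (l.+2 - t <= deg x)%N -> U x &
    forall x, U x -> (\bigcup_(C in N l) C) x -> covered s' l x].
  elim: t => [|t [s1 [U1 [gs1 ss1 oU1 dU1 cU1]]]].
    (* A step for the empty set tightens the hulls, as [extends] demands. *)
    have [|||s' [U [gs' ss' oU _ cU]]] := @stage_step l s set0 0 gs.
    - exact: closed0.
    - by [].
    - by [].
    exists s', U; split => // x _; rewrite subn0 leqNgt ltnS.
    by rewrite /deg degree_le.
  have [tl|lt] := ltnP t l.+2; last first.
    exists s1, U1; split => // x Cx _; apply: dU1 => //.
    by move: lt; rewrite -subn_eq0 => /eqP ->.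
  pose k := (l.+2 - t.+1)%N.
  have kE : (l.+2 - t = k.+1)%N by rewrite /k subnSK.
  pose D := [set x | [/\ (\bigcup_(C in N l) C) x, (k <= deg x)%N & ~ U1 x]].
  have cD : closed D.
    apply: near_closed => x; near=> y => -[[C NC Cy] ky nUy].
    have yx i : signature l.+1 i y -> signature l.+1 i x.
      by move: i; near: y; exact: signature_conservative.
    split.
    - by exists C => //; have [] : signature l.+1 (l, C) x by apply: yx; split.
    - by apply: leq_trans ky _; exact: degree_sub.
    - move: nUy; near: y; apply: (@closed_near _ (~` U1)).
      exact: open_closedC.
  have [||s2 [U2 [gs2 ss2 oU2 DU2 cU2]]] := @stage_step l s1 D k gs1 cD.
  - by move=> x [].
  - move=> x [Cx kx nUx]; apply/eqP; rewrite eqn_leq kx andbT leqNgt.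
    by apply/negP => ltk; apply: nUx; apply: dU1 => //; rewrite kE.
  exists s2, (U1 `|` U2); split=> //.
  - exact: extends_trans ss1 ss2.
  - exact: openU.
  - move=> x Cx kx; have [Ux|nUx] := pselect (U1 x); first by left.
    by right; apply: DU2.
  - move=> x [Ux|Ux] Cx; last exact: cU2.
    have [i mi bi] := cU1 x Ux Cx.
    have ni : (i.1 < size_of s1)%N.
      by have [H _] := stage_coloured gs1; apply: H; exists x.
    have [_ /(_ i ni)[m12 b12 _]] := ss2.
    by exists i; [exact: m12|rewrite b12].
have [s' [U [gs' ss' _ dU cU]]] := claim l.+2.
exists s'; split=> // x Cx; apply: cU => //; apply: dU => //.
by rewrite subnn.
Unshelve. all: by end_near. Qed.

Definition empty_stage := Stage 0 (fun=> set0) (fun=> set0) (fun=> set0).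

Lemma good_empty_stage : good_stage 0 empty_stage.
Proof.
split=> //=.
- by split=> [i [x []]|i j x []].
- by move=> x; apply: nearW.
- by move=> i; exact: open0.
- by move=> i x.
- by move=> S [i Si] /(_ i i Si Si) [x []].
- by move=> i x.
- by move=> i [x []].
Qed.

Lemma stages_exist : exists s : nat -> stage, forall l,
  [/\ good_stage l (s l), extends (s l) (s l.+1) &
      forall x, (\bigcup_(C in N l) C) x -> covered (s l.+1) l x].
Proof.
have /choice[f fP] : forall ls : nat * stage, exists s', good_stage ls.1 ls.2 ->
    [/\ good_stage ls.1.+1 s', extends ls.2 s' &
      forall x, (\bigcup_(C in N ls.1) C) x -> covered s' ls.1 x].
  move=> [l s]; have [/stage_process[s' Hs']|ng] := pselect (good_stage l s).
    by exists s'.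
  by exists s.
pose fix S l := if l is l'.+1 then f (l', S l') else empty_stage.
have gS l : good_stage l (S l).
  elim: l => [|l IHl]; first exact: good_empty_stage.
  by have [] := fP (l, S l) IHl.
by exists S => l; have [] := fP (l, S l) (gS l).
Qed.

Section limit.
Variable s : nat -> stage.
Hypothesis sP : forall l, [/\ good_stage l (s l), extends (s l) (s l.+1) &
  forall x, (\bigcup_(C in N l) C) x -> covered (s l.+1) l x].

Definition limit i := closure (\bigcup_l member (s l) i).

Lemma good_s l : good_stage l (s l). Proof. by have [] := sP l. Qed.

Lemma active l i : member (s l) i !=set0 -> (i.1 < size_of (s l))%N.
Proof. by have [H _] := stage_coloured (good_s l); exact: H. Qed.

Lemma extends_lt l m : (l < m)%N -> extends (s l) (s m).
Proof.
elim: m => // m IHm; rewrite ltnS leq_eqVlt => /orP[/eqP->|lm].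
  by have [] := sP m.
by apply: extends_trans (IHm lm) _; have [] := sP m.
Qed.

Lemma member_mono l m i : (l <= m)%N -> member (s l) i `<=` member (s m) i.
Proof.
rewrite leq_eqVlt => /orP[/eqP->//|lm] x mx.
have [|+ _ _] := (extends_lt lm).2 i; last exact.
by apply: active; exists x.
Qed.

Lemma size_mono l m : (l <= m)%N -> (size_of (s l) <= size_of (s m))%N.
Proof.
by rewrite leq_eqVlt => /orP[/eqP->//|lm]; have [] := extends_lt lm.
Qed.

Lemma limit_hull l i : (i.1 < size_of (s l))%N -> limit i `<=` hull (s l) i.
Proof.
move=> il; have [_ /(_ i il)[_ _ h]] := extends_lt (ltnSn l).
apply: subset_trans h; apply: closureS => x [m _ mx].
have [ml|lm] := leqP m l.+1.
  by apply: (stage_hull (good_s _)); exact: member_mono ml _ mx.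
have [|_ _] := (extends_lt lm).2 i.
  by apply: leq_trans il _; exact: size_mono.
apply; apply: subset_closure; exact: (stage_hull (good_s _)).
Qed.

Lemma limit_active i : limit i !=set0 -> exists l, (i.1 < size_of (s l))%N.
Proof.
move=> [x /closure_nonempty[y [l _ ly]]]; exists l.
by apply: active; exists y.
Qed.

Lemma limit_bound l i : (i.1 < size_of (s l))%N -> closed (bound (s l) i) ->
  limit i `<=` bound (s l) i.
Proof.
move=> il cB; rewrite [X in _ `<=` X](closure_id _).1//.
apply: closureS => x [m _ mx].
have := stage_bound (good_s m) mx.
have [ml|lm|->//] := ltngtP m l.
  have [|_ -> _//] := (extends_lt ml).2 i.
  by apply: active; exists x.
by have [_ -> _] := (extends_lt lm).2 i il.
Qed.

(** Linked limits have intersecting hulls at all stages, hence intersecting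
    members at a stage at which all of finitely many indices are active. *)
Lemma limit_binary : binary (range limit).
Proof.
move=> F FN linkF G finG [A0 GA0] GF.
have /choice[idx idxP] : forall A, exists i, F A -> limit i = A.
  move=> A; have [/FN[i _ <-]|nFA] := pselect (F A); first by exists i.
  by have [i _ _] := FN _ (GF _ GA0); exists i.
have /choice[f fP] : forall A, exists l, F A -> ((idx A).1 < size_of (s l))%N.
  move=> A; have [FA|nFA] := pselect (F A); last by exists 0%N.
  have [|l Hl] := @limit_active (idx A); last by exists l.
  by rewrite idxP//; have [x [Ax _]] := linkF _ _ FA FA; exists x.
have [t Gt] := (finite_seqP G).1 finG.
pose l := (\max_(A <- t) f A)%N.
have Hl A : G A -> ((idx A).1 < size_of (s l))%N.
  move=> GA; apply: leq_trans (fP A (GF _ GA)) _; apply: size_mono.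
  by apply: leq_bigmax_seq => //; move: GA; rewrite Gt.
have [||x Hx] := stage_binary (good_s l) (S := idx @` G).
- by exists (idx A0), A0.
- move=> _ _ [A GA <-] [B GB <-]; apply: (stage_nerve (good_s l)).
  have [x [Ax Bx]] := linkF _ _ (GF _ GA) (GF _ GB).
  by exists x; split; apply: limit_hull; rewrite ?Hl ?idxP//; exact: GF.
exists x => A GA; rewrite /= -(idxP A (GF _ GA)).
apply: subset_closure; exists l => //; apply: Hx.
by exists A.
Qed.

Lemma limit_k_network : k_network (\bigcup_l N l) -> k_network (range limit).
Proof.
move=> kN K U cK oU KU.
have [F [finF FN KF FU]] := kN K U cK oU KU.
have /choice[lev levP] : forall C, exists l, F C -> N l C.
  move=> C; have [/FN[l _ NC]|nFC] := pselect (F C); first by exists l.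
  by exists 0%N.
pose J C := [set i | (exists2 x, K x & member (s (lev C).+1) i x) /\
  bound (s (lev C).+1) i = C].
exists (limit @` (\bigcup_(C in F) J C)); split.
- apply: finite_image; apply: bigcup_finite => // C FC.
  apply: (@sub_finite_set _ _
    [set i | exists2 x, K x & member (s (lev C).+1) i x]); first by move=> i [].
  by apply: coloured_compact (stage_coloured (good_s _)) _ _ _ => //;
    exact: stage_conservative (good_s _).
- by move=> _ [i _ <-]; exists i.
- move=> x Kx; have [C FC Cx] := KF x Kx; have NC := levP C FC.
  have [_ _ /(_ x)[|i mi Ni]] := sP (lev C); first by exists C.
  have bi : bound (s (lev C).+1) i = C.
    apply: (member_unique Ni NC _ Cx).
    exact: (stage_bound (good_s _)).
  exists (limit i); last by apply: subset_closure; exists (lev C).+1.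
  by exists i => //; exists C => //; split => //; exists x.
- move=> x [_ [i [C FC [[y Ky my] bi]] <-] lx]; apply: FU; exists C => //.
  rewrite -bi; apply: limit_bound lx; first by apply: active; exists y.
  by rewrite bi; apply: closedN; exact: levP.
Qed.

End limit.

End construction.

Theorem discrete_k_network_super (X : topologicalType) (N : nat -> set_system X) :
  collectionwise_normal X -> (forall l, N l `<=` closed) ->
  (forall l, discrete_family (N l) id) -> k_network (\bigcup_l N l) -> super X.
Proof.
move=> cwnX cN dN kN.
have [s sP] := stages_exist cwnX cN dN.
exists (range (limit s)); last exact: limit_binary sP.
split; first exact: (limit_k_network cN dN sP).
by move=> _ [i _ <-]; exact: closed_closure.
Qed.

(** * Metrizable spaces *)

Lemma well_founded_comparison (T : choiceType) : exists lt : T -> T -> Prop,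
  (forall P : set T, P !=set0 -> exists2 x, P x & forall y, lt y x -> ~ P y) /\
  (forall x y, x <> y -> lt x y \/ lt y x).
Proof.
have [r wor] := wochoice.well_ordering_principle T.
have least (P : set T) x : P x -> exists z, P z /\ (forall y, P y -> r z y).
  move=> Px; have [|z [[Pz minz] _]] := wor [pred z | `[< P z >]].
    by exists x; apply/asboolP.
  exists z; split; first exact/asboolP.
  by move=> y Py; apply: minz; apply/asboolP.
have r_refl x : r x x.
  by have [z [-> /(_ x erefl)]] := least [set x] x erefl.
have r_anti x y : r x y -> r y x -> x = y.
  move=> xy yx; have [|z [_ uz]] := wor (pred2 x y).
    by exists x; rewrite inE eqxx.
  by rewrite -(uz x) ?(uz y)//; split; rewrite ?inE ?eqxx ?orbT// => t;
    rewrite inE => /orP[]/eqP->.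
exists (fun x y => r x y /\ x <> y); split=> [P [x Px]|x y xy].
  have [z [Pz minz]] := least P x Px.
  by exists z => // y [yz nyz] Py; apply: nyz; apply: r_anti => //; exact: minz.
have [z [zxy minz]] := least [set x; y] x (or_introl erefl).
case: zxy => zE; [left|right]; rewrite -{1}zE; split=> //; try exact: nesym.
  by apply: minz; right.
by apply: minz; left.
Qed.

Section metric.
Variables (R : realType) (X : topologicalType) (d : X -> X -> R).
Hypothesis d0 : forall x y, d x y = 0%R <-> x = y.
Hypothesis dC : forall x y, d x y = d y x.
Hypothesis dT : forall x y z, (d x z <= d x y + d y z)%R.
Hypothesis nbhsd : forall x,
  nbhs x = nbhs_ball_ (fun x e => [set y | (d x y < e)%R]) x.

Local Open Scope ring_scope.

Lemma dxx x : d x x = 0. Proof. exact/d0. Qed.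

Lemma d_ge0 x y : 0 <= d x y.
Proof. by have := dT x y x; rewrite dxx (dC y x); lra. Qed.

Lemma near_ball x e : 0 < e -> \forall y \near x, d x y < e.
Proof. by move=> e0; change (nbhs x [set y | d x y < e]); rewrite nbhsd; exists e. Qed.

Lemma nbhs_metric x (A : set X) : nbhs x A ->
  exists2 e, 0 < e & forall y, d x y < e -> A y.
Proof. by rewrite nbhsd => -[e e0 H]; exists e. Qed.

Lemma open_metric (A : set X) :
  (forall x, A x -> exists2 e, 0 < e & forall y, d x y < e -> A y) -> open A.
Proof.
move=> HA; rewrite openE => x /HA[e e0 He]; rewrite /interior /=.
exact: filterS (near_ball x e0).
Qed.

Lemma open_ball x e : open [set y | d x y < e].
Proof.
apply: open_metric => y /= xy; exists (e - d x y); first by rewrite subr_gt0.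
by move=> z yz; apply: le_lt_trans (dT x y z) _; lra.
Qed.

Lemma metric_accessible : accessible_space X.
Proof.
move=> x y xy; exists [set z | d x z < d x y]; split.
- exact: open_ball.
- rewrite inE /= dxx lt_neqAle d_ge0 andbT eq_sym; apply/eqP => /d0 E.
  by rewrite E eqxx in xy.
- by rewrite inE /= ltxx.
Qed.

(** Every point of a member of the family is the center of a ball that meets no
    other member; the balls of a quarter of the radius are used.  Near a point
    [z] outside all members, a ball that comes close to [z] has a radius that is
    large in comparison, so that balls from two members cannot both do so. *)
Lemma metric_collectionwise_normal : collectionwise_normal X.
Proof.
split=> [|I D F cF dF]; first exact: metric_accessible.
pose U i := [set z | exists x r, [/\ F i x, 0 < r,
  forall j y, D j -> F j y -> d x y < r -> j = i & d x z < r / 4]].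
exists U; split.
- move=> i Di; apply: open_metric => z [x [r [Fx r0 Hr xz]]].
  exists (r / 4 - d x z); first by rewrite subr_gt0.
  move=> y zy; exists x, r; split=> //.
  by apply: le_lt_trans (dT x z y) _; lra.
- move=> z; have [[i0 [Di0 Fz]]|nF] := pselect (exists i, D i /\ F i z).
    have [W nW HW] := dF z; have [r0 r00 Hr0] := nbhs_metric nW.
    have z0 j y : D j -> F j y -> d z y < r0 -> j = i0.
      move=> Dj Fy zy; apply: HW => //; first by exists y; split => //; exact: Hr0.
      by exists z; split => //; exact: nbhs_singleton.
    have [|e e0 He] := nbhs_metric (near_ball z (e := r0 / 4) _); first by lra.
    exists [set y | d z y < r0 / 4]; first by apply: near_ball; lra.
    suff key i : D i -> U i `&` [set y | d z y < r0 / 4] !=set0 -> i = i0.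
      by move=> i j Di Dj /(key _ Di) -> /(key _ Dj) ->.
    move=> Di [w [[x [r [Fx rpos Hr xw]]] /= zw]].
    have zx := dT z w x; rewrite (dC w x) in zx.
    have [rr0|r0r] := leP r r0; first by apply: (z0 _ x) => //; lra.
    by apply/esym; apply: (Hr _ z) => //; rewrite dC; lra.
  have /nbhs_metric[e e0 He] : \forall y \near z, forall i, D i /\ F i y -> D i /\ F i z.
    exact: discrete_conservative dF cF z.
  have far i x : D i -> F i x -> e <= d z x.
    move=> Di Fx; rewrite leNgt; apply/negP => zx; apply: nF; exists i.
    by apply: (He x zx).
  exists [set y | d z y < e / 4]; first by apply: near_ball; lra.
  move=> i j Di Dj [w [[x [r [Fx r0 Hr xw]]] /= zw]].
  move=> [w' [[x' [r' [Fx' r'0 Hr' xw']]] /= zw']].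
  apply: contrapT => ij.
  have rx : r <= d x x'.
    by rewrite leNgt; apply/negP => /(Hr _ _ Dj Fx') ji; apply: ij.
  have rx' : r' <= d x x'.
    by rewrite leNgt dC; apply/negP => /(Hr' _ _ Di Fx) ji; apply: ij.
  have zx := dT z w x; have ex := far _ _ Di Fx; rewrite (dC w x) in zx.
  have t1 := dT x w x'; have t2 := dT w z x'; have t3 := dT z w' x'.
  rewrite (dC w z) in t2; rewrite (dC w' x') in t3.
  lra.
- move=> i Di x Fx; have [W nW HW] := dF x; have [r r0 Hr] := nbhs_metric nW.
  exists x, r; split=> //; last by rewrite dxx; lra.
  move=> j y Dj Fy xy; apply: HW => //; first by exists y; split => //; exact: Hr.
  by exists x; split => //; exact: nbhs_singleton.
Qed.

Section stone.
Variable lt : X -> X -> Prop.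
Hypothesis lt_least : forall P : set X, P !=set0 ->
  exists2 x, P x & forall y, lt y x -> ~ P y.
Hypothesis lt_total : forall x y, x <> y -> lt x y \/ lt y x.

(** These are the points that lie deep, with respect to [h], in the ball of
    radius [e] around [a] and in no such ball around an earlier center, where
    [lt] is a well order.  The cores for distinct centers are [h] apart. *)
Definition stone_core (e h : R) a := [set y | (forall z, d y z < h -> d a z < e) /\
  forall b, lt b a -> e <= d b y].

Definition stone_piece e h a := [set z | exists2 y, stone_core e h a y & d y z < h / 3].

Lemma stone_core_separated e h a b y z :
  stone_core e h a y -> stone_core e h b z -> d y z < h -> a = b.
Proof.
move=> [Hy Ly] [Hz Lz] yz; apply: contrapT => /lt_total[ab|ba].
  by have := Lz _ ab; have := Hy _ yz; lra.
have zy : d z y < h by rewrite dC.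
by have := Ly _ ba; have := Hz _ zy; lra.
Qed.

Lemma stone_piece_closure e h a z : 0 < e -> 0 < h ->
  closure (stone_piece e h a) z -> d a z < e *+ 2.
Proof.
move=> e0 h0 /(_ _ (near_ball z e0))[w [[y [Hy _] yw] /= zw]].
have aw : d a w < e by apply: Hy; lra.
by have := dT a w z; rewrite (dC w z) mulr2n; lra.
Qed.

Definition stone_family e h : set_system X :=
  [set closure (stone_piece e h a) | a in [set: X]].

Lemma stone_family_discrete e h : 0 < h -> discrete_family (stone_family e h) id.
Proof.
move=> h0 z; exists [set w | d z w < h / 6]; first by apply: near_ball; lra.
have core a : closure (stone_piece e h a) `&` [set w | d z w < h / 6] !=set0 ->
    exists2 y, stone_core e h a y & d z y < h / 2.
  move=> [w [clw zw]].
  have [w' [[y Hy yw] zw']] := clw _ (open_nbhs_nbhs (conj (open_ball z (h / 6)) zw)).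
  by exists y => //; have := dT z w' y; rewrite (dC w' y); move: zw' => /=; lra.
move=> _ _ [a _ <-] [b _ <-] /core[y Hy zy] /core[y' Hy' zy'].
rewrite (stone_core_separated Hy Hy')//.
by have := dT y z y'; rewrite (dC y z); lra.
Qed.

(** The first center whose ball contains [x] will do. *)
Lemma stone_cover e x : 0 < e -> exists a, d a x < e /\
  exists n : nat, stone_core e n.+1%:R^-1 a x.
Proof.
move=> e0; have [|a /= ax mina] := lt_least (P := [set a | d a x < e]).
  by exists x; rewrite /= dxx.
exists a; split=> //; have [n Hn] := ltr_add_invr ax.
exists n; split=> [z xz|b /mina /negP]; last by rewrite -leNgt.
by apply: le_lt_trans (dT a x z) _; apply: lt_trans Hn; rewrite ltrD2l.
Qed.

Definition stone_network (l : nat) : set_system X :=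
  if @choice.unpickle (nat * nat)%type l is Some (k, n)
  then stone_family k.+1%:R^-1 n.+1%:R^-1 else set0.

Lemma stone_network_k_network : k_network (\bigcup_l stone_network l).
Proof.
apply: local_k_network => x U oU Ux.
have [e e0 He] := nbhs_metric (open_nbhs_nbhs (conj oU Ux)).
have [|k Hk] := @ltr_add_invr R 0 (e / 3); first by lra.
have k0 : 0 < k.+1%:R^-1 :> R by rewrite invr_gt0 ltr0n.
have [a [ax [n Hn]]] := stone_cover x k0.
have n0 : 0 < n.+1%:R^-1 :> R by rewrite invr_gt0 ltr0n.
pose C := closure (stone_piece k.+1%:R^-1 n.+1%:R^-1 a).
exists [set C]; rewrite bigcup_set1; split.
- exact: finite_set1.
- move=> _ ->; exists (choice.pickle (k, n)) => //.
  by rewrite /stone_network choice.pickleK; exists a.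
- move=> z /(stone_piece_closure k0 n0); rewrite mulr2n => az; apply: He.
  move: az ax Hk; move: (k.+1%:R^-1) => q az ax Hk.
  by have := dT x a z; rewrite (dC x a); lra.
- have h0 : 0 < n.+1%:R^-1 / 3 :> R by rewrite divr_gt0.
  apply: filterS (near_ball x h0) => z xz; apply: subset_closure.
  by exists x.
Qed.

Lemma stone_network_discrete l : discrete_family (stone_network l) id.
Proof.
rewrite /stone_network; case: choice.unpickle => [[k n]|].
  by apply: stone_family_discrete; rewrite invr_gt0 ltr0n.
by move=> x; exists setT => //; exact: filterT.
Qed.

Lemma stone_network_closed l : stone_network l `<=` closed.
Proof.
rewrite /stone_network; case: choice.unpickle => [[k n]|//].
by move=> _ [a _ <-]; exact: closed_closure.
Qed.

End stone.

End metric.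

Theorem metrizable_super (R : realType) (X : topologicalType) :
  metrizable X R -> super X.
Proof.
move=> [d [d0 dC dT nbhsd]].
have [lt [lt_least lt_total]] := well_founded_comparison X.
apply: (discrete_k_network_super (metric_collectionwise_normal d0 dC dT nbhsd)).
- exact: (@stone_network_closed R X d lt).
- exact: (stone_network_discrete dC dT nbhsd lt_total).
- exact: (stone_network_k_network d0 dC dT nbhsd lt_least).
Qed.

(** * Aleph-spaces *)

(** Closures of the members are a k-network again: apply the given one to an
    open set whose closure is in the original open set. *)
Theorem aleph_super (X : topologicalType) :
  collectionwise_normal X -> aleph_space X -> super X.
Proof.
move=> cwnX [[hX regX] [N kN [Nn dN NE]]].
apply: (discrete_k_network_super (N := fun n => closure @` Nn n) cwnX).
- by move=> n _ [A _ <-]; exact: closed_closure.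
- move=> n x; have [W nW HW] := dN n x; exists W°; first exact: nbhs_interior.
  move=> _ _ [A NA <-] [B NB <-] [y [Ay Wy]] [z [Bz Wz]].
  have oW := @open_interior _ W.
  have [y' [Ay' Wy']] := Ay _ (open_nbhs_nbhs (conj oW Wy)).
  have [z' [Bz' Wz']] := Bz _ (open_nbhs_nbhs (conj oW Wz)).
  suff -> : A = B by [].
  by apply: HW => //; [exists y'|exists z']; split => //; exact: interior_subset.
- move=> K U cK oU KU.
  have [V [oV KV VU]] :=
    collectionwise_normal_normal cwnX (compact_closed hX cK) oU KU.
  have [F [finF FN KF FV]] := kN K V cK oV KV.
  exists (closure @` F); split.
  + exact: finite_image.
  + move=> _ [A /FN + <-]; rewrite NE => -[n _ NA].
    by exists n => //; exists A.
  + move=> x /KF[A FA Ax]; exists (closure A); first by exists A.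
    exact: subset_closure.
  + move=> x [_ [A FA <-] Ax]; apply: VU; apply: closureS Ax => y Ay.
    by apply: FV; exists A.
Qed.

Theorem theorem2 (R : realType) (X : topologicalType) :
  [/\ hausdorff_space X -> supercompact X -> super X,
      GO_space X -> super X,
      metrizable X R -> super X
    & collectionwise_normal X -> aleph_space X -> super X].
Proof.
split.
- exact: supercompact_super.
- exact: GO_super.
- exact: metrizable_super.
- exact: aleph_super.
Qed.
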